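(* Let $n\geq 1$, $m\geq 0$ and $d\geq 0$ be integers, let $\epsilon_+,\epsilon_-\in\{0,1\}$, and let $a_1,\ldots,a_d$ be complex numbers with $|a_r|<1$ ($r=1,\ldots,d$) such that any non-real parameters $a_r$ arise in complex conjugate pairs. Assume $$d\leq 2(m+n)+\epsilon_++\epsilon_- .$$ Let $f(x_1,\ldots,x_n)$ be an arbitrary symmetric polynomial of degree at most $2m+1$ in each of the variables $x_1,\ldots,x_n$, and put $$R(\boldsymbol{\xi})=\frac{f\bigl(\cos(\xi_1),\ldots,\cos(\xi_n)\bigr)}{\prod_{1\leq r\leq d,\;1\leq j\leq n}\bigl(1+2a_r\cos(\xi_j)+a_r^2\bigr)},\qquad \boldsymbol{\xi}=(\xi_1,\ldots,\xi_n).$$ Then $$\frac{1}{(2\pi)^n\,n!}\int_0^\pi\cdots\int_0^\pi R(\boldsymbol{\xi})\,\rho(\boldsymbol{\xi})\,\mathrm{d}\xi_1\cdots\mathrm{d}\xi_n=\sum_{\hat\lambda\in\Lambda^{(m,n)}}R\bigl(\boldsymbol{\xi}^{(m,n)}_{\hat\lambda}\bigr)\,\rho\bigl(\boldsymbol{\xi}^{(m,n)}_{\hat\lambda}\bigr)\Bigl(H^{(m,n)}\bigl(\boldsymbol{\xi}^{(m,n)}_{\hat\lambda}\bigr)\Bigr)^{-1},$$ where $$\rho(\boldsymbol{\xi}):=\prod_{1\leq j\leq n}2^{\epsilon_++\epsilon_-}\bigl(1+\epsilon_+\cos(\xi_j)\bigr)\bigl(1-\epsilon_-\cos(\xi_j)\bigr)\prod_{1\leq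 j<k\leq n}\bigl(\cos(\xi_j)-\cos(\xi_k)\bigr)^2,$$ $$H^{(m,n)}(\boldsymbol{\xi}):=\prod_{1\leq j\leq n}h^{(m+n)}(\xi_j),$$ $$h^{(m+n)}(\xi):=2(m+n)-d+\epsilon_++\epsilon_-+\sum_{1\leq r\leq d}\frac{1-a_r^2}{1+2a_r\cos(\xi)+a_r^2},$$ and the index set $\Lambda^{(m,n)}$ and the nodes $\boldsymbol{\xi}^{(m,n)}_{\hat\lambda}$, built from the roots of the Bernstein-Szegő polynomial of degree $m+n$, are as defined in the context.
   Context: Index set: $\Lambda^{(m,n)}:=\{\lambda=(\lambda_1,\ldots,\lambda_n)\in\mathbb{Z}^n\mid m\geq\lambda_1\geq\lambda_2\geq\cdots\geq\lambda_n\geq 0\}$. Bernstein-Szegő polynomials: let $$w(\xi):=\frac{2^{\epsilon_++\epsilon_-}(1+\epsilon_+\cos\xi)(1-\epsilon_-\cos\xi)}{2\pi\prod_{1\leq r\leq d}(1+2a_r\cos\xi+a_r^2)},\qquad 0<\xi<\pi,$$ which is positive because the parameters $a_r$ are real or occur in complex conjugate pairs. The Bernstein-Szegő polynomials $p_l(x)$, $l=0,1,2,\ldots$, are the real polynomials with $\deg p_l=l$ and positive leading coefficient, obtained by Gram-Schmidt orthonormalization of $1,x,x^2,\ldots$ with $x=\cos\xi$, i.e. $\int_0^\pi p_l(\cos\xi)\,p_k(\cos\xi)\,w(\xi)\,\mathrm{d}\xi=\delta_{l,k}$. By the general theory of orthogonal polynomials, for $N\geq 1$ all $N$ roots of $p_N$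 are simple and lie in $(-1,1)$; they are written as $\cos\bigl(\xi^{(N)}_{\hat l}\bigr)$, $\hat l=0,\ldots,N-1$, with $$0<\xi^{(N)}_0<\xi^{(N)}_1<\cdots<\xi^{(N)}_{N-1}<\pi.$$ Nodes: for $\hat\lambda\in\Lambda^{(m,n)}$, $$\boldsymbol{\xi}^{(m,n)}_{\hat\lambda}:=\Bigl(\xi^{(m+n)}_{\hat\lambda_1+n-1},\,\xi^{(m+n)}_{\hat\lambda_2+n-2},\,\ldots,\,\xi^{(m+n)}_{\hat\lambda_{n-1}+1},\,\xi^{(m+n)}_{\hat\lambda_n}\Bigr).$$ *)

(* Defs.v *)
From HB Require Import structures.
From mathcomp Require Import all_boot all_order all_algebra.
From mathcomp Require Import all_classical all_reals all_analysis.
From mathcomp Require Import complex.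
(* mpoly is not imported: its notations clash with those of mathcomp-analysis *)
From mathcomp Require mpoly.

Set Implicit Arguments.
Unset Strict Implicit.
Unset Printing Implicit Defensive.

Import Order.TTheory GRing.Theory Num.Theory.
Import numFieldNormedType.Exports.

Local Open Scope ring_scope.
Local Open Scope complex_scope.

Section Integration.
Variable R : realType.

Definition cintegral (F : R -> R[i]) : R[i] :=
  (\int[@lebesgue_measure R]_(x in `[0, pi]%classic) complex.Re (F x)) +i*
  (\int[@lebesgue_measure R]_(x in `[0, pi]%classic) complex.Im (F x)).

Fixpoint iterated_cintegral (n : nat) : (n.-tuple R -> R[i]) -> R[i] :=
  match n with
  | 0 => fun F => F [tuple]
  | n'.+1 => fun F =>
      cintegral (fun x => iterated_cintegral (fun t : n'.-tuple R => F (cons_tuple x t)))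
  end.

End Integration.

Section BernsteinSzego.
Variables (R : realType) (d : nat) (ep em : bool) (a : 'I_d -> R[i]).

(* The pairing s fixes the indices of real parameters, or permutes them among
   equal values, and is fixed-point free on the indices of non-real ones. *)
Definition conjugate_pairs : Prop :=
  exists s : 'I_d -> 'I_d, involutive s /\ forall r, a (s r) = (a r)^*.

Definition bs_factor (r : 'I_d) (xi : R) : R[i] :=
  1 + 2 * a r * (cos xi)%:C + a r ^+ 2.

(* The booleans ep, em in {0,1} are epsilon_+ and epsilon_-. *)
Definition bs_numerator (xi : R) : R :=
  2 ^+ (ep + em) * (1 + ep%:R * cos xi) * (1 - em%:R * cos xi).

(* Real and positive when |a r| < 1 and conjugate_pairs hold. *)
Definition bs_weight (xi : R) : R[i] :=
  (bs_numerator xi)%:C / ((2 * pi)%:C * \prod_(r < d) bs_factor r xi).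

Definition is_bs_polys (p : nat -> {poly R}) : Prop :=
  [/\ forall l, size (p l) = l.+1,
      forall l, 0 < lead_coef (p l)
    & forall l k, cintegral (fun xi =>
        ((p l).[cos xi] * (p k).[cos xi])%:C * bs_weight xi) = (l == k)%:R].

(* p N has degree N, so these N distinct values cos (xi l) are all its roots. *)
Definition is_bs_angles (p : nat -> {poly R}) (N : nat) (xi : nat -> R) : Prop :=
  [/\ forall l, (l < N)%N -> 0 < xi l < pi,
      forall k l, (k < l < N)%N -> xi k < xi l
    & forall l, (l < N)%N -> root (p N) (cos (xi l))].

Definition rho (n : nat) (x : n.-tuple R) : R :=
  (\prod_(j < n) bs_numerator (tnth x j)) *
  \prod_(j < n) \prod_(k < n | (j < k)%N)
    (cos (tnth x j) - cos (tnth x k)) ^+ 2.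

Definition hfun (N : nat) (xi : R) : R[i] :=
  (2 * N)%:R - d%:R + ep%:R + em%:R +
  \sum_(r < d) (1 - a r ^+ 2) / bs_factor r xi.

Definition Hfun (m n : nat) (x : n.-tuple R) : R[i] :=
  \prod_(j < n) hfun (m + n) (tnth x j).

Definition Rfun (n : nat) (f : mpoly.mpoly n R[i]) (x : n.-tuple R) : R[i] :=
  mpoly.meval (fun j => (cos (tnth x j))%:C) f /
  \prod_(r < d) \prod_(j < n) bs_factor r (tnth x j).

End BernsteinSzego.

(* Integer sequences m >= l_1 >= ... >= l_n >= 0 have entries in 'I_m.+1. *)
Definition Lambda (m n : nat) : {set n.-tuple 'I_m.+1} :=
  [set l : n.-tuple 'I_m.+1 | sorted geq [seq val i | i <- l]].

(* With 0-based j, the shift n - (j + 1) is n.-1 - j. *)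
Definition node (R : realType) (m n : nat) (xi : nat -> R)
    (l : n.-tuple 'I_m.+1) : n.-tuple R :=
  [tuple xi (tnth l j + (n.-1 - j))%N | j < n].

Definition mpoly_partial_degree_le (K : nzRingType) (n : nat) (f : mpoly.mpoly n K)
    (D : nat) : Prop :=
  forall mon, mpoly.mcoeff mon f != 0 -> forall j : 'I_n, (mpoly.fun_of_multinom mon j <= D)%N.

(* Main.v *)
(* With z = e^(i xi), A(z) = prod (1 + a_r z), B(z) = (1 + ep z)(1 - em z),
   s = (-1)^em and M = 2N + ep + em, the weight is |B|^2 / (2 pi |A|^2).  Put
   V(z) = z^M A(1/z) and P = V + s A.  The quotient z^-N P(z) / B(z) is a
   polynomial of degree <= N in cos xi, orthogonal to all lower degrees, hence a
   multiple of p_N: so the e^(+- i xi_l) are zeros of P, and together with the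
   zeros of B they are all its M zeros.

   If g has degree <= 2N - 1, Bezout writes z^(M-1) g(cos xi) B(z) B(1/z) as
   X A + Y V, so that the integrand is z X / V + z Y / A; its integral is read
   off at z = 0 because int (K(z)/A(z) + K(1/z)/A(1/z)) = 2 pi K(0).  Lagrange
   interpolation of X - s Y at the zeros of P gives the same value as a sum of
   residues, and z P'/V = z (V'/V - A'/A) is the function h.  This is the
   one-variable Gauss quadrature with the stated weights.

   In n variables f times the squared Vandermonde product has degree at most
   2(m+n) - 1 in each variable, so the quadrature applies iteratively; the terms
   with a repeated node vanish, and the others are permuted n! to one onto the
   strictly decreasing tuples of nodes, i.e. onto Lambda. *)

Require Import Defs.
From mathcomp Require Import all_boot all_order all_algebra.
From mathcomp Require Import all_classical all_reals all_analysis.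
From mathcomp Require Import complex.
From mathcomp Require mpoly.
From mathcomp Require Import all_fingroup.
From mathcomp Require Import ring zify.

Set Implicit Arguments.
Unset Strict Implicit.
Unset Printing Implicit Defensive.

Import Order.TTheory GRing.Theory Num.Theory.
Import numFieldNormedType.Exports.

Local Open Scope ring_scope.
Local Open Scope complex_scope.

(** * Integration of complex-valued continuous functions *)

(** Taken componentwise because [cintegral] integrates real and imaginary parts separately. *)
Definition ccontinuous (R : realType) (F : R -> R[i]) : Prop :=
  continuous (fun x => complex.Re (F x)) /\ continuous (fun x => complex.Im (F x)).

Lemma ccontinuous_cst (R : realType) (c : R[i]) : ccontinuous (fun _ : R => c).
Proof. by split=> x; apply: cst_continuous. Qed.

Section ContinuousFun.
Variables (R : realType) (f g : R -> R).
Hypotheses (cf : continuous f) (cg : continuous g).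

Lemma continuous_funD : continuous (fun x => f x + g x).
Proof. by move=> x; apply: cvgD; [exact: cf | exact: cg]. Qed.

Lemma continuous_funB : continuous (fun x => f x - g x).
Proof. by move=> x; apply: cvgB; [exact: cf | exact: cg]. Qed.

Lemma continuous_funM : continuous (fun x => f x * g x).
Proof. by move=> x; apply: cvgM; [exact: cf | exact: cg]. Qed.

End ContinuousFun.

Lemma eq_continuous_fun (R : realType) (f g : R -> R) :
  f =1 g -> continuous f -> continuous g.
Proof. by move=> /funext ->. Qed.

Lemma ccontinuousD (R : realType) (F G : R -> R[i]) :
  ccontinuous F -> ccontinuous G -> ccontinuous (fun x => F x + G x).
Proof.
move=> [cF dF] [cG dG]; split.
- apply: eq_continuous_fun (continuous_funD cF cG) => y.
  by case: (F y) => ? ?; case: (G y).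
- apply: eq_continuous_fun (continuous_funD dF dG) => y.
  by case: (F y) => ? ?; case: (G y).
Qed.

Lemma ccontinuousM (R : realType) (F G : R -> R[i]) :
  ccontinuous F -> ccontinuous G -> ccontinuous (fun x => F x * G x).
Proof.
move=> [cF dF] [cG dG]; split.
- apply: eq_continuous_fun
    (continuous_funB (continuous_funM cF cG) (continuous_funM dF dG)) => y.
  by case: (F y) => ? ?; case: (G y).
- apply: eq_continuous_fun
    (continuous_funD (continuous_funM cF dG) (continuous_funM dF cG)) => y.
  by case: (F y) => ? ?; case: (G y).
Qed.

Lemma ccontinuousV (R : realType) (F : R -> R[i]) :
  (forall x, F x != 0) -> ccontinuous F -> ccontinuous (fun x => (F x)^-1).
Proof.
move=> F0 [cF dF].
(* The squared modulus is the common denominator of both components of 1/F. *)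
have cN : continuous (fun x =>
    (complex.Re (F x) * complex.Re (F x) + complex.Im (F x) * complex.Im (F x))^-1).
  move=> x; apply: cvgV; last first.
    exact: (continuous_funD (continuous_funM cF cF) (continuous_funM dF dF)).
  have := F0 x; apply: contra; rewrite -!expr2 paddr_eq0 ?sqr_ge0 // !sqrf_eq0.
  by rewrite eq_complex.
split.
- apply: eq_continuous_fun (continuous_funM cF cN) => y.
  rewrite -!expr2; by case: (F y).
- apply: eq_continuous_fun
    (continuous_funM (continuous_funM (fun x => @cst_continuous R R (-1) x) dF) cN) => y.
  rewrite -!expr2; by case: (F y) => u v /=; rewrite mulN1r mulNr.
Qed.

Lemma ccontinuousX (R : realType) (F : R -> R[i]) k :
  ccontinuous F -> ccontinuous (fun x => F x ^+ k).
Proof.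
move=> cF; elim: k => [|k IH]; first exact: ccontinuous_cst.
rewrite (_ : (fun _ => _) = fun x => F x * F x ^+ k); first exact: ccontinuousM.
by apply: funext => x; rewrite exprS.
Qed.

Lemma ccontinuous_sum (R : realType) (I : Type) (r : seq I) (P : pred I)
    (F : I -> R -> R[i]) :
  (forall i, ccontinuous (F i)) ->
  ccontinuous (fun x => \sum_(i <- r | P i) F i x).
Proof.
move=> cF; elim: r => [|i r IH].
  rewrite (_ : (fun _ => _) = fun=> 0); first exact: ccontinuous_cst.
  by apply: funext => x; rewrite big_nil.
rewrite (_ : (fun _ => _) =
  fun x => (if P i then F i x else 0) + \sum_(j <- r | P j) F j x).
  by apply: ccontinuousD => //; case: (P i) => //; exact: ccontinuous_cst.
by apply: funext => x; rewrite big_cons; case: (P i); rewrite // add0r.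
Qed.

Lemma ccontinuous_horner (R : realType) (K : {poly R[i]}) (F : R -> R[i]) :
  ccontinuous F -> ccontinuous (fun x => K.[F x]).
Proof.
move=> cF; rewrite (_ : (fun _ => _) = fun x => \sum_(i < size K) K`_i * F x ^+ i).
  apply: ccontinuous_sum => i; apply: ccontinuousM; first exact: ccontinuous_cst.
  exact: ccontinuousX.
by apply: funext => x; rewrite horner_coef.
Qed.

Lemma ccontinuous_cos (R : realType) : ccontinuous (fun x : R => (cos x)%:C).
Proof.
by split; [exact: continuous_cos | move=> x; exact: cst_continuous].
Qed.

Lemma integrable_continuous (R : realType) (f : R -> R) : continuous f ->
  (@lebesgue_measure R).-integrable `[0, pi]%classic (EFin \o f).
Proof.
move=> cf; apply: continuous_compact_integrable.
  exact: segment_compact.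
exact: continuous_subspaceT.
Qed.

Lemma cintegralD (R : realType) (F G : R -> R[i]) :
  ccontinuous F -> ccontinuous G ->
  cintegral (fun x => F x + G x) = cintegral F + cintegral G.
Proof.
move=> [cF dF] [cG dG]; rewrite /cintegral.
under eq_Rintegral do rewrite (raddfD (@complex.Re R : Rcomplex R -> R)).
under [X in _ +i* X]eq_Rintegral do rewrite (raddfD (@complex.Im R : Rcomplex R -> R)).
by rewrite !RintegralD //; exact: integrable_continuous.
Qed.

Lemma cintegralZ (R : realType) (c : R[i]) (F : R -> R[i]) : ccontinuous F ->
  cintegral (fun x => c * F x) = c * cintegral F.
Proof.
move=> [cF dF]; rewrite /cintegral; case: c => u v.
have E1 x : complex.Re ((u +i* v) * F x) = u * complex.Re (F x) - v * complex.Im (F x).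
  by case: (F x).
have E2 x : complex.Im ((u +i* v) * F x) = u * complex.Im (F x) + v * complex.Re (F x).
  by case: (F x) => ? ? /=; rewrite addrC.
have cM w (f : R -> R) : continuous f -> continuous (fun x => w * f x).
  by move=> cf; apply: continuous_funM => // x; exact: cst_continuous.
under eq_Rintegral do rewrite E1.
under [X in _ +i* X]eq_Rintegral do rewrite E2.
rewrite RintegralB ?RintegralD ?RintegralZl //;
  try by apply: integrable_continuous => //; exact: cM.
Qed.

Lemma cintegral_sum (R : realType) (I : Type) (r : seq I) (F : I -> R -> R[i]) :
  (forall i, ccontinuous (F i)) ->
  cintegral (fun x => \sum_(i <- r) F i x) = \sum_(i <- r) cintegral (F i).
Proof.
move=> cF; elim: r => [|i r IH].
  rewrite big_nil (_ : (fun _ => _) = fun=> 0 * 0).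
    by rewrite cintegralZ ?mul0r //; exact: ccontinuous_cst.
  by apply: funext => x; rewrite big_nil mul0r.
rewrite big_cons -IH -cintegralD //; last exact: ccontinuous_sum.
by congr cintegral; apply: funext => x; rewrite big_cons.
Qed.

Lemma normr_Re_le (R : realType) (z : R[i]) (B : R) : `|z| <= B%:C ->
  `|complex.Re z| <= B.
Proof. by move=> h; rewrite -lecR (le_trans _ h) // normc_ge_Re. Qed.

Lemma normr_Im_le (R : realType) (z : R[i]) (B : R) : `|z| <= B%:C ->
  `|complex.Im z| <= B.
Proof.
move=> h; rewrite -(normrN (complex.Im z)) -ReiNIm; apply: normr_Re_le.
by rewrite normrM (_ : `|'i| = 1 :> R[i]) ?mulr1 // normc_def /= expr0n expr1n add0r sqrtr1.
Qed.

(** The factor 2 comes from bounding the two real integrals separately; the constant is immaterial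
    for the geometric decay argument that uses the bound. *)
Lemma cintegral_norm_le (R : realType) (F : R -> R[i]) (B : R) : ccontinuous F ->
  (forall x, `|F x| <= B%:C) -> `|cintegral F| <= (2 * (B * pi))%:C.
Proof.
move=> [cF dF] hB.
have le_int (f : R -> R) : continuous f -> (forall x, `|f x| <= B) ->
    `|\int[@lebesgue_measure R]_(x in `[0, pi]%classic) f x| <= B * pi.
  move=> cf hf; apply: le_trans (le_normr_Rintegral _ _) _ => //.
    exact: integrable_continuous.
  apply: (@le_trans _ _ (\int[@lebesgue_measure R]_(x in `[0, pi]%classic) B)).
    apply: le_Rintegral => //.
    - apply: integrable_continuous => x; apply: (@continuous_comp _ _ _ f Num.norm).
        exact: cf.
      exact: norm_continuous.
    - by apply: integrable_continuous => x; exact: cst_continuous.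
  rewrite Rintegral_cst //= (_ : fine _ = pi) //.
  have := @lebesgue_measure_itv R `[0, pi].
  by rewrite /= lte_fin pi_gt0 => -> /=; rewrite subr0.
rewrite /cintegral [X in `|X|]complexE (le_trans (ler_normD _ _)) //= normrM.
rewrite (_ : `|'i| = 1 :> R[i]) ?mul1r; last first.
  by rewrite normc_def /= expr0n expr1n add0r sqrtr1.
rewrite mulr_natl mulr2n rmorphD /= lerD //.
  by rewrite normc_def /= expr0n addr0 sqrtr_sqr lecR; apply: le_int => // x; exact: normr_Re_le.
by rewrite normc_def /= expr0n addr0 sqrtr_sqr lecR; apply: le_int => // x; exact: normr_Im_le.
Qed.

(** * Means over the unit circle *)

Definition eix (R : realType) (t : R) : R[i] := cos t +i* sin t.

Section Circle.
Variable R : realType.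
Implicit Types t : R.

Lemma eixN t : eix (- t) = (eix t)^-1.
Proof.
rewrite /eix cosN sinN.
apply/eqP; rewrite eq_complex /= cos2Dsin2 !divr1 !eqxx.
done.
Qed.

Lemma normc_eix t : `|eix t| = 1.
Proof. by rewrite normc_def /= cos2Dsin2 sqrtr1. Qed.

Lemma eix_neq0 t : eix t != 0.
Proof. by rewrite -normr_gt0 normc_eix ltr01. Qed.

Lemma normc_eixV t : `|(eix t)^-1| = 1.
Proof. by rewrite -eixN normc_eix. Qed.

Lemma eixX t k : eix t ^+ k = eix (t *+ k).
Proof.
elim: k => [|k IH]; first by rewrite mulr0n /eix cos0 sin0.
rewrite exprS IH mulrS /eix cosD sinD.
by apply/eqP; rewrite eq_complex /= eqxx addrC eqxx.
Qed.

Lemma cos_eix t : (cos t)%:C = (eix t + (eix t)^-1) / 2.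
Proof.
rewrite -eixN /eix cosN sinN.
have -> : (cos t +i* sin t) + (cos t -i* sin t) = (cos t)%:C * 2.
  by apply/eqP; rewrite eq_complex /=; apply/andP; split; apply/eqP; ring.
by rewrite mulfK // pnatr_eq0.
Qed.

Lemma ccontinuous_eix : ccontinuous (@eix R).
Proof. by split; [exact: continuous_cos | exact: continuous_sin]. Qed.

Lemma ccontinuous_eixV : ccontinuous (fun t => (eix t)^-1).
Proof. by apply: ccontinuousV; [exact: eix_neq0 | exact: ccontinuous_eix]. Qed.

Lemma sin_pi_mulrn k : sin (pi *+ k) = 0 :> R.
Proof.
elim: k => [|k IH]; first by rewrite mulr0n sin0.
by rewrite mulrS sinD sinpi IH mul0r mulr0 addr0.
Qed.

Lemma continuous_cos_mulrn k : continuous (fun y : R => cos (y *+ k)).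
Proof.
move=> x; apply: continuous_comp; last exact: continuous_cos.
rewrite (_ : (fun y : R => _) = fun y : R => y * k%:R).
  by apply: cvgM; [exact: cvg_id | exact: cvg_cst].
by apply: funext => y; rewrite mulr_natr.
Qed.

Lemma Rintegral_cos k : (0 < k)%N ->
  \int[@lebesgue_measure R]_(x in `[0, pi]%classic) cos (x *+ k) = 0.
Proof.
move=> k0; have kn0 : k%:R != 0 :> R by rewrite pnatr_eq0 -lt0n.
have dF (x : R) : is_derive x 1 (fun y : R => k%:R^-1 * sin (y * k%:R)) (cos (x *+ k)).
  rewrite -[x *+ k]mulr_natr.
  apply: is_derive_eq.
  by rewrite scaler0 add0r /GRing.scale /= mulr1; field.
have cF := @continuous_cos_mulrn k.
have cS : continuous (fun y : R => k%:R^-1 * sin (y * k%:R)).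
  move=> x; apply/differentiable_continuous/derivable1_diffP.
  by have [] := dF x.
rewrite /Rintegral (@continuous_FTC2 _ _ (fun y : R => k%:R^-1 * sin (y * k%:R))) //.
- by rewrite mulr_natr sin_pi_mulrn mul0r sin0 !mulr0 /= subr0.
- exact: pi_gt0.
- exact: continuous_subspaceT.
- split.
  + by move=> x _; exact: ex_derive.
  + apply: cvg_at_right_filter; exact: cS.
  + apply: cvg_at_left_filter; exact: cS.
- by move=> x _; rewrite derive1E; exact: derive_val.
Qed.

(** As t runs through [0, pi], [eix t] and its inverse together cover the unit circle, so this is an
    integral over the full circle, in a form adapted to even functions of t. *)
Definition symint (F : R[i] -> R[i]) : R[i] :=
  cintegral (fun t : R => F (eix t) + F (eix t)^-1).

(** On the circle z^k + z^-k is 2 cos(k t): the imaginary part cancels and only k = 0 survives. *)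
Lemma symint_exp k : symint (fun z => z ^+ k) = (k == 0%N)%:R * (2 * pi)%:C.
Proof.
rewrite /symint /cintegral.
under eq_Rintegral do rewrite -eixN !eixX mulNrn /eix cosN /=.
under [X in _ +i* X]eq_Rintegral do rewrite -eixN !eixX mulNrn /eix sinN /= subrr.
rewrite Rintegral_cst //= mul0r.
case: eqP => [->|/eqP k0].
  under eq_Rintegral do rewrite mulr0n cos0.
  rewrite Rintegral_cst //= (_ : fine _ = pi) ?mul1r //.
  have := @lebesgue_measure_itv R `[0, pi].
  by rewrite /= lte_fin pi_gt0 => -> /=; rewrite subr0.
have cF := @continuous_cos_mulrn k.
rewrite RintegralD //; try exact: integrable_continuous.
by rewrite Rintegral_cos ?lt0n // addr0 mul0r.
Qed.

End Circle.

Lemma lt1_geometric_le0 (R : realType) (x r B : R) :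
  0 <= r < 1 -> (forall k, x <= r ^+ k * B) -> x <= 0.
Proof.
move=> /andP[r0 r1] h; have c0 : (r ^+ k * B @[k --> \oo] --> (0 * B : R))%classic.
  apply: cvgM; last exact: cvg_cst.
  by apply: cvg_expr; rewrite ger0_norm.
rewrite mul0r in c0.
rewrite -(cvg_lim _ c0) //; apply: limr_ge; first by apply/cvg_ex; exists 0.
by apply: nearW.
Qed.

(** * Fractions whose denominator has no zeros in the closed unit disk *)

Section DiskPoly.
Variable R : realType.
Local Notation C := R[i].
Implicit Types (s : seq C) (K : {poly C}).

(** The polynomial A, over a list of parameters so that induction can remove them one by one. *)
Definition disk_poly s : {poly C} := \prod_(a <- s) (1 + a *: 'X).

Lemma horner_disk_poly s z : (disk_poly s).[z] = \prod_(a <- s) (1 + a * z).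
Proof. by rewrite horner_prod; apply: eq_bigr => a _; rewrite !hornerE. Qed.

Lemma disk_factor_neq0 (a z : C) : `|a| < 1 -> `|z| <= 1 -> 1 + a * z != 0.
Proof.
move=> a1 z1; apply/eqP => /eqP; rewrite addrC addr_eq0 => /eqP h.
have : `|a * z| < 1 by rewrite normrM (le_lt_trans _ a1) // ler_piMr.
by rewrite h normrN1 ltxx.
Qed.

Lemma disk_poly_neq0 s z : all (fun a : C => `|a| < 1) s -> `|z| <= 1 ->
  (disk_poly s).[z] != 0.
Proof.
move=> hs z1; rewrite horner_disk_poly prodf_seq_neq0.
by apply/allP => a /(allP hs) a1 /=; exact: disk_factor_neq0.
Qed.

(** On the circle |1 + a z| >= 1 - |a|, so the product of the 1/(1 - |a|) is a bound. *)
Lemma disk_polyV_bounded s : all (fun a : C => `|a| < 1) s ->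
  exists B : R, forall z : C, `|z| = 1 -> `|(disk_poly s).[z]^-1| <= B%:C.
Proof.
elim: s => [_|a s IH /andP[a1 /IH[B hB]]].
  by exists 1 => z _; rewrite /disk_poly big_nil hornerC invr1 normr1.
exists ((1 - Normc.normc a)^-1 * B) => z z1.
rewrite /disk_poly big_cons hornerM invfM normrM rmorphM /=.
apply: ler_pM; rewrite ?normr_ge0 ?hB // !hornerE normfV.
rewrite (fmorphV (real_complex R)) lef_pV2.
- rewrite rmorphB /= -/(`|a|) lerBlDr.
  have -> : (Normc.normc a)%:C = `|a * z| by rewrite normrM z1 mulr1.
  rewrite -[X in X <= _](@normr1 C) -[X in `|X| <= _](addrK (a * z)).
  by rewrite (le_trans (ler_normD _ _)) // normrN.
- by rewrite posrE normr_gt0 disk_factor_neq0 ?z1.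
- by rewrite posrE ltcR subr_gt0 -ltcR.
Qed.

Lemma ccontinuous_circle_frac s K : all (fun a : C => `|a| < 1) s ->
  ccontinuous (fun t : R => K.[eix t] / (disk_poly s).[eix t]) /\
  ccontinuous (fun t : R => K.[(eix t)^-1] / (disk_poly s).[(eix t)^-1]).
Proof.
move=> hs; split.
- apply: ccontinuousM; first by apply: ccontinuous_horner; exact: ccontinuous_eix.
  apply: ccontinuousV.
    by move=> t; apply: disk_poly_neq0 => //; rewrite normc_eix.
  by apply: ccontinuous_horner; exact: ccontinuous_eix.
- apply: ccontinuousM; first by apply: ccontinuous_horner; exact: ccontinuous_eixV.
  apply: ccontinuousV.
    by move=> t; apply: disk_poly_neq0 => //; rewrite normc_eixV.
  by apply: ccontinuous_horner; exact: ccontinuous_eixV.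
Qed.

Lemma symint_frac_sum s (I : Type) (r : seq I) (c : I -> C) (K : I -> {poly C}) :
  all (fun a : C => `|a| < 1) s ->
  symint (fun z => (\sum_(i <- r) c i *: K i).[z] / (disk_poly s).[z]) =
  \sum_(i <- r) c i * symint (fun z => (K i).[z] / (disk_poly s).[z]).
Proof.
move=> hs; rewrite /symint.
have cK i : ccontinuous (fun t : R => (K i).[eix t] / (disk_poly s).[eix t] +
    (K i).[(eix t)^-1] / (disk_poly s).[(eix t)^-1]).
  by have [? ?] := ccontinuous_circle_frac (K i) hs; exact: ccontinuousD.
transitivity (cintegral (fun t : R => \sum_(i <- r) c i *
    ((K i).[eix t] / (disk_poly s).[eix t] +
     (K i).[(eix t)^-1] / (disk_poly s).[(eix t)^-1]))).
  congr cintegral; apply: funext => t; rewrite !horner_sum !mulr_suml -big_split /=.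
  by apply: eq_bigr => i _; rewrite !hornerZ mulrDr !mulrA.
rewrite cintegral_sum; last first.
  by move=> i; apply: ccontinuousM => //; exact: ccontinuous_cst.
by apply: eq_bigr => i _; rewrite cintegralZ.
Qed.

(* For J_k the integral of 'X^k over the product including a, and k > 0, the
   product without a gives J_k + a J_(k+1) = 0; as the J_k are bounded and
   |a| < 1, they vanish. *)
Lemma symint_exp_frac s k : all (fun a : C => `|a| < 1) s ->
  symint (fun z => ('X^k).[z] / (disk_poly s).[z]) = (k == 0%N)%:R * (2 * pi)%:C.
Proof.
elim: s k => [|a s IH] k hs.
  rewrite -symint_exp; congr symint; apply: funext => z.
  by rewrite /disk_poly big_nil hornerC divr1 hornerXn.
have /andP[a1 hs'] := hs.
set J := fun k => symint (fun z => ('X^k).[z] / (disk_poly (a :: s)).[z]).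
have rec j : J j + a * J j.+1 = (j == 0%N)%:R * (2 * pi)%:C.
  rewrite -(IH j hs') /J.
  have := @symint_frac_sum (a :: s) _ [:: 0%N; 1%N] (fun i => if i is 0%N then 1 else a)
    (fun i => 'X^(j + i)) hs.
  rewrite !big_cons !big_nil !addr0 mul1r addn0 addn1 => <-.
  congr cintegral; apply: funext => t.
  have E (z : C) : `|z| = 1 -> (1 *: 'X^j + a *: 'X^(j.+1) : {poly C}).[z] /
      (disk_poly (a :: s)).[z] = ('X^j).[z] / (disk_poly s).[z].
    move=> z1; rewrite /disk_poly big_cons hornerM !hornerE exprS.
    rewrite (_ : z ^+ j + a * (z * z ^+ j) = z ^+ j * (1 + a * z)); last by ring.
    by rewrite invfM mulrA mulfK ?disk_factor_neq0 ?z1.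
  by rewrite !E ?normc_eix ?normc_eixV.
have J0 j : (0 < j)%N -> J j = 0.
  move=> j0.
  have iter L : J j = (- a) ^+ L * J (j + L)%N.
    elim: L => [|L ->]; first by rewrite expr0 mul1r addn0.
    have := rec (j + L)%N; rewrite addn_eq0 eqn0Ngt j0 /= mul0r => /eqP.
    by rewrite addr_eq0 addnS => /eqP ->; rewrite exprSr -mulrA mulNr.
  have [B hB] := disk_polyV_bounded hs.
  suff e : Normc.normc (J j) = 0.
    by apply/eqP; rewrite -normr_eq0 (_ : `|J j| = (Normc.normc (J j))%:C) // e.
  apply/eqP; rewrite eq_le; apply/andP; split; last first.
    by rewrite -lecR; exact: (normr_ge0 (J j)).
  apply: (@lt1_geometric_le0 _ _ (Normc.normc a) (2 * ((B + B) * pi))).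
    by rewrite -lecR -ltcR a1 andbT; exact: (normr_ge0 a).
  move=> L; rewrite -lecR -[X in X <= _]/(`|J j|) (iter L) normrM normrX normrN.
  rewrite [X in _ <= X]rmorphM rmorphXn /=; apply: ler_wpM2l; first exact: exprn_ge0.
  have [? ?] := ccontinuous_circle_frac 'X^(j + L) hs.
  apply: cintegral_norm_le; first exact: ccontinuousD.
  move=> t; rewrite rmorphD /= (le_trans (ler_normD _ _)) // lerD //.
    by rewrite hornerXn normrM normrX normc_eix expr1n mul1r hB // normc_eix.
  by rewrite hornerXn normrM normrX normc_eixV expr1n mul1r hB // normc_eixV.
have [k0|k0] := posnP k; last by rewrite -/(J k) J0 // mul0r.
by have := rec k; rewrite (J0 k.+1) // mulr0 addr0 k0.
Qed.

(** Mean value property at 0, the poles lying outside the closed disk. By linearity it reduces to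
    monomials, of which only the constant one contributes. *)
Lemma symint_frac s K : all (fun a : C => `|a| < 1) s ->
  symint (fun z => K.[z] / (disk_poly s).[z]) = K.[0] * (2 * pi)%:C.
Proof.
move=> hs; rewrite horner_coef0 -{1}[K]coefK poly_def.
rewrite symint_frac_sum //.
under eq_bigr do rewrite symint_exp_frac // mulrA.
rewrite -mulr_suml; congr (_ * _).
have [->|K0] := eqVneq K 0; first by rewrite size_poly0 big_ord0 coef0.
have sK : (0 < size K)%N by rewrite size_poly_gt0.
rewrite (bigD1 (Ordinal sK)) //= mulr1 big1 ?addr0 // => i.
by rewrite -val_eqE /= => /negbTE ->; rewrite mulr0.
Qed.

(** An even G is half of G(t) + G(-t), which is the symmetrised fraction with numerator K1 + K2;
    hence pi in place of 2 pi. *)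
Lemma cintegral_even s (G : R -> C) (K1 K2 : {poly C}) :
  all (fun a : C => `|a| < 1) s ->
  (forall t, G (- t) = G t) ->
  (forall t, G t = K1.[eix t] / (disk_poly s).[eix t] +
    K2.[(eix t)^-1] / (disk_poly s).[(eix t)^-1]) ->
  cintegral G = pi%:C * (K1.[0] + K2.[0]).
Proof.
move=> hs Gev GE.
have [c1 c1'] := ccontinuous_circle_frac K1 hs.
have [c2 c2'] := ccontinuous_circle_frac K2 hs.
have cG : ccontinuous G.
  by rewrite (funext GE); exact: ccontinuousD.
have E : G = (fun t => (1 / 2) * ((K1 + K2).[eix t] / (disk_poly s).[eix t] +
    (K1 + K2).[(eix t)^-1] / (disk_poly s).[(eix t)^-1])).
  apply: funext => t; have E2 : G t = (1 / 2) * (G t + G (- t)).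
    by rewrite Gev; field.
  rewrite E2 !GE eixN invrK !hornerD; congr (_ * _).
  by rewrite !mulrDl; ring.
have [c3 c3'] := ccontinuous_circle_frac (K1 + K2) hs.
rewrite E cintegralZ; last exact: ccontinuousD.
rewrite -/(symint (fun z => (K1 + K2).[z] / (disk_poly s).[z])) symint_frac //.
by rewrite hornerD rmorphM /= rmorph_nat; field.
Qed.

End DiskPoly.

(** * Polynomial identities *)

Section PolyLemmas.
Variable F : fieldType.
Implicit Types (g P Q : {poly F}).

Lemma horner_deriv_prod (I : Type) (r : seq I) (p : I -> {poly F}) z :
  all (fun i => (p i).[z] != 0) r ->
  (\prod_(i <- r) p i)^`().[z] =
  (\prod_(i <- r) p i).[z] * \sum_(i <- r) (p i)^`().[z] / (p i).[z].
Proof.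
elim: r => [_|i r IH /andP[hi /IH {}IH]]; first by rewrite !big_nil derivC hornerC mulr0.
by rewrite !big_cons derivM hornerD !hornerM IH; field.
Qed.

(** The Bezout cofactor of P is reduced modulo Q, and the quotient is moved to the other
    cofactor. *)
Lemma bezout_split P Q U : coprimep P Q -> Q != 0 ->
  exists2 X : {poly F} * {poly F}, U = X.1 * P + X.2 * Q & (size X.1 < size Q)%N.
Proof.
move=> /Bezout_eq1_coprimepP[[u v] /= uv] Q0.
exists ((U * u) %% Q, U * v + (U * u) %/ Q * P) => /=; last by rewrite ltn_modp.
rewrite -[LHS]mulr1 -uv mulrDr [U * (u * P)]mulrA {1}(divp_eq (U * u) Q).
by ring.
Qed.

Lemma coefM_top P Q m n : (size P <= m.+1)%N -> (size Q <= n.+1)%N ->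
  (P * Q)`_(m + n) = P`_m * Q`_n.
Proof.
move=> sP sQ; rewrite coefM (bigD1 (inord m)) //= inordK ?ltnS ?leq_addr // addKn.
rewrite big1 ?addr0 // => i; rewrite -val_eqE /= inordK ?ltnS ?leq_addr // => im.
have [mi|mi] := ltnP m i.
  by rewrite (@nth_default _ _ P) ?mul0r // (leq_trans sP).
have {}mi : (i < m)%N by rewrite ltn_neqAle im.
by rewrite (@nth_default _ _ Q) ?mulr0 // (leq_trans sQ) //; lia.
Qed.

(** Reversal of the coefficients trades z for 1/z. It later turns z X / V into a fraction in 1/z
    over A(1/z). *)
Lemma horner_revV P m z : z != 0 -> (size P <= m)%N ->
  z ^+ m.-1 * (\poly_(i < m) P`_(m.-1 - i)).[z^-1] = P.[z].
Proof.
move=> z0 sP; rewrite horner_poly (horner_coef_wide _ sP) mulr_sumr.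
rewrite [RHS](reindex_inj rev_ord_inj) /=; apply: eq_bigr => i _.
have -> : (m - i.+1 = m.-1 - i)%N by lia.
have im : (i <= m.-1)%N by have := ltn_ord i; lia.
by rewrite mulrCA exprVn -exprB ?unitfE ?leq_subr // subKn.
Qed.

(** With x = (z + 1/z)/2, the term z^D x^i equals 2^-i (z^2 + 1)^i z^(D - i), a polynomial as i <=
    D. *)
Lemma joukowski_lift g D : (size g <= D.+1)%N ->
  exists2 h : {poly F}, (size h <= D.*2.+1)%N
  & forall z, z != 0 -> h.[z] = z ^+ D * g.[(z + z^-1) / 2].
Proof.
move=> sg; exists (\sum_(i < D.+1) g`_i *: (2^-1 ^+ i *: (('X^2 + 1) ^+ i * 'X^(D - i)))).
  apply: leq_trans (size_sum _ _ _) _; apply/bigmax_leqP => i _.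
  do 2 apply: leq_trans (size_scale_leq _ _) _.
  have s2 : size ('X^2 + 1 : {poly F}) = 3 by rewrite -polyC1 size_XnaddC.
  rewrite size_mulXn; last by rewrite expf_neq0 // -size_poly_gt0 s2.
  have h : (size (('X^2 + 1 : {poly F}) ^+ i) <= (2 * i).+1)%N.
    by rewrite (leq_trans (size_poly_exp_leq _ _)) // s2.
  have iD : (i <= D)%N by rewrite -ltnS.
  by rewrite (leq_trans (leq_add (leqnn _) h)) //; lia.
move=> z z0; rewrite (horner_coef_wide _ sg) horner_sum mulr_sumr.
apply: eq_bigr => i _; rewrite !(hornerZ, hornerM, horner_exp, hornerD, hornerX, hornerC).
have -> : z ^+ D = z ^+ (D - i) * z ^+ i by rewrite -exprD subnK // -ltnS.
have -> : (z + z^-1) / 2 = (z ^+ 2 + 1) * 2^-1 * z^-1.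
  (* The constant is generalized because [field] would ask for 2 to be nonzero, which may fail in
     F. *)
  by move: (2^-1) => h; field.
rewrite !exprMn [z^-1 ^+ i]exprVn.
have : z ^+ i != 0 by rewrite expf_neq0.
move: (z ^+ i) ((z ^+ 2 + 1) ^+ i) (z ^+ (D - i)) (2^-1 ^+ i) => u v w t u0.
by field.
Qed.

(** Lagrange interpolation: Q is the sum of the Q(z) L_z / L_z(z), where L_z is the product over the
    roots other than z, and P'(z) is the leading coefficient of P times L_z(z). The top coefficients
    are then compared. *)
Lemma sum_residue P Q (rs : seq F) : uniq rs -> all (root P) rs ->
  size P = (size rs).+1 -> (size Q <= size rs)%N ->
  lead_coef P * \sum_(z <- rs) Q.[z] / P^`().[z] = Q`_(size rs).-1.
Proof.
move=> urs rP sP sQ.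
have hP : P = lead_coef P *: \prod_(z <- rs) ('X - z%:P).
  by apply: all_roots_prod_XsubC => //; rewrite uniq_rootsE.
have lP : lead_coef P != 0 by rewrite lead_coef_eq0 -size_poly_eq0 sP.
pose L z := \prod_(y <- rem z rs) ('X - y%:P).
have PL z : z \in rs -> P = lead_coef P *: (('X - z%:P) * L z).
  by move=> zr; rewrite {1}hP (perm_big _ (perm_to_rem zr)) big_cons.
have dP z : z \in rs -> P^`().[z] = lead_coef P * (L z).[z].
  move=> zr; rewrite {1}(PL z zr) derivZ derivM derivXsubC mul1r.
  by rewrite !hornerE subrr mul0r addr0.
have L0 z y : z \in rs -> y \in rs -> y != z -> (L z).[y] = 0.
  move=> zr yr yz; apply/eqP; rewrite -/(root (L z) y) /L root_prod_XsubC.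
  by rewrite rem_filter // mem_filter /= yz.
have Lz z : z \in rs -> (L z).[z] != 0.
  move=> zr; rewrite -/(root (L z) z) /L root_prod_XsubC.
  by rewrite rem_filter // mem_filter /= eqxx.
have sL z : z \in rs -> size (L z) = size rs.
  by move=> zr; rewrite /L size_prod_XsubC size_rem // prednK // -has_predT; apply/hasP; exists z.
pose D := \sum_(z <- rs) (Q.[z] / (L z).[z]) *: L z.
(* [Q - D] vanishes on all of [rs] and has degree below their number. *)
have eD : Q = D.
  apply/eqP; rewrite -subr_eq0; apply/eqP/(@roots_geq_poly_eq0 _ _ rs) => //.
    apply/allP => y yr; rewrite rootE hornerD hornerN subr_eq0 /D horner_sum.
    rewrite (bigD1_seq y) //= hornerZ divfK ?Lz // big_seq_cond big1 ?addr0 //.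
    by move=> z /andP[zr zy]; rewrite hornerZ (L0 z y) ?mulr0 // eq_sym.
  apply: leq_trans (size_polyD _ _) _; rewrite geq_max sQ size_polyN /=.
  apply: leq_trans (size_sum _ _ _) _; apply/bigmax_leqP_seq => z zr _.
  by apply: leq_trans (size_scale_leq _ _) _; rewrite sL.
rewrite [in RHS]eD coef_sum mulr_sumr !big_seq; apply: eq_bigr => z zr.
rewrite coefZ dP // invfM -(sL z zr) -[(L z)`__]lead_coefE.
rewrite (monicP (monic_prod_XsubC _ _ _)) mulr1.
by rewrite mulrCA mulVKf.
Qed.

End PolyLemmas.

(** * The numerator of the weight and its palindromic multiples *)

Section Numerator.
Variable F : numFieldType.
Variables ep em : bool.

Definition num_poly : {poly F} := (1 + ep%:R *: 'X) * (1 - em%:R *: 'X).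

Lemma horner_num_poly z : num_poly.[z] = (1 + ep%:R * z) * (1 - em%:R * z).
Proof. by rewrite !hornerE. Qed.

Lemma num_polyV z : z != 0 ->
  z ^+ (ep + em) * num_poly.[z^-1] = (-1) ^+ em * num_poly.[z].
Proof.
move=> z0; rewrite !horner_num_poly.
by case: ep; case: em => /=; rewrite ?addn0 ?addn1 ?expr0 ?expr1; field.
Qed.

(* The quotients E_k = (z^(k+e) + s z^-k) / num_poly(z), with e = ep + em and
   s = (-1)^em, satisfy the Chebyshev recursion E_(k+1) + E_(k-1) = (z + 1/z) E_k. *)
Lemma num_poly_quotient k :
  exists2 w : {poly F}, (size w <= k.+1)%N & forall z, z != 0 ->
    w.[(z + z^-1) / 2] * num_poly.[z] =
    z ^+ (k + (ep + em)) + (-1) ^+ em * z ^- k.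
Proof.
pose ok k (w : {poly F}) := (size w <= k.+1)%N /\ forall z, z != 0 ->
    w.[(z + z^-1) / 2] * num_poly.[z] =
    z ^+ (k + (ep + em)) + (-1) ^+ em * z ^- k.
suff [[w [? ?]] _] : (exists w, ok k w) /\ (exists w, ok k.+1 w) by exists w.
elim: k => [|k [[u [su hu]] [v [sv hv]]]].
- split.
    (* Starting values by direct division: E_0 is a constant, and with x = (z + 1/z)/2 the quotient
       E_1 is 2x, 2x - 1, -2x - 1, -2x for (ep, em) = (0,0), (1,0), (0,1), (1,1). *)
    exists (if em then -1 else if ep then 1 else 2)%:P; split=> [|z z0].
      by rewrite size_polyC leq_b1.
    rewrite hornerC horner_num_poly.
    by case: ep; case: em => /=; field.
  exists ((if em then -2 else 2) *: 'X - (ep (+) em)%:R%:P); split.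
    apply: leq_trans (size_polyD _ _) _.
    rewrite geq_max size_polyN (leq_trans (size_polyC_leq1 _)) // andbT.
    by rewrite (leq_trans (size_scale_leq _ _)) // size_polyX.
  move=> z z0; rewrite horner_num_poly.
  by case: ep; case: em => /=; rewrite !hornerE /=; field.
split; first by exists v.
exists (2 *: 'X * v - u); split.
  apply: leq_trans (size_polyD _ _) _; rewrite geq_max size_polyN (leq_trans su) ?andbT; last by lia.
  rewrite -scalerAl (leq_trans (size_scale_leq _ _)) // (leq_trans (size_polyMleq _ _)) //.
  by rewrite size_polyX.
move=> z z0; rewrite !hornerD hornerN hornerM hornerZ hornerX.
rewrite [LHS](_ : _ = (z + z^-1) * (v.[(z + z^-1) / 2] * num_poly.[z])
  - u.[(z + z^-1) / 2] * num_poly.[z]); last by field.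
rewrite hv // hu // !addSn !exprS !invfM.
have zk : z ^+ k != 0 by rewrite expf_neq0.
by field; rewrite zk z0.
Qed.

(** For j <= N the quotient is E_k with k = N - j. For j >= N + e, where e = ep + em, the monomials
    swap roles and k = j - N - e, at the cost of the sign s. In between only j = N + 1 with ep = em
    = 1 can occur, where the monomials cancel. *)
Lemma palindrome_quotient N j : (j <= 2 * N + ep + em)%N ->
  exists2 w : {poly F}, (size w <= N.+1)%N & forall z, z != 0 ->
    z ^+ N * (w.[(z + z^-1) / 2] * num_poly.[z]) =
    z ^+ (2 * N + ep + em - j) + (-1) ^+ em * z ^+ j.
Proof.
move=> hj; have [jN|Nj] := leqP j N.
  have [w sw hw] := num_poly_quotient (N - j).
  exists w => [|z z0]; first by lia.
  rewrite hw // mulrDr mulrCA -exprD; congr (z ^+ _ + _ * _); first by lia.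
  by rewrite -exprB ?unitfE ?leq_subr ?subKn.
have [jN|Nj'] := leqP (N + (ep + em)) j.
  have [w sw hw] := num_poly_quotient (j - (N + (ep + em))).
  exists ((-1) ^+ em *: w) => [|z z0].
    by rewrite (leq_trans (size_scale_leq _ _)) //; lia.
  rewrite hornerZ -mulrA hw // !mulrDr !mulrA -(mulrA _ _ ((-1) ^+ em)) -expr2 sqrr_sign mulr1.
  rewrite [RHS]addrC [z ^+ N * _]mulrC -mulrA -exprD; congr (_ * z ^+ _ + _); first by lia.
  by rewrite -exprB ?unitfE //; [congr (z ^+ _); lia | lia].
have -> : (2 * N + ep + em - j = j)%N by lia.
have -> : em by lia.
by exists 0 => [|z z0]; rewrite ?size_poly0 // horner0 mul0r mulr0 mulN1r subrr.
Qed.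

End Numerator.

(** * The nodal polynomial and the one-variable quadrature *)

Section Nodal.
Variables (R : realType) (s : seq R[i]) (N : nat) (ep em : bool).
Local Notation C := R[i].
Hypothesis hs : all (fun a : C => `|a| < 1) s.
Let M := (2 * N + ep + em)%N.
Hypothesis hM : (size s <= M)%N.
Hypothesis hN : (0 < N)%N.
Let A := disk_poly s.
Let B := num_poly C ep em.
Let sg : C := (-1) ^+ em.

(** This is z^M A(1/z) in factored form, since z (1 + a/z) = z + a; the degree, the leading
    coefficient and the roots can be read off. *)
Definition rev_disk_poly : {poly C} := 'X^(M - size s) * \prod_(a <- s) ('X - (- a)%:P).
Let V := rev_disk_poly.

Definition nodal_poly : {poly C} := V + sg *: A.
Let P := nodal_poly.

Lemma rev_disk_polyE z : z != 0 -> V.[z] = z ^+ M * A.[z^-1].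
Proof.
move=> z0; rewrite /V /rev_disk_poly hornerM hornerXn horner_prod horner_disk_poly.
rewrite -{2}(subnK hM) exprD -mulrA; congr (_ * _).
elim: (s) => [|a s' IH]; first by rewrite !big_nil expr0 mulr1.
by rewrite !big_cons {}IH /= exprS hornerXsubC; field.
Qed.

Lemma monic_rev_disk_poly : V \is monic.
Proof. by rewrite monicMl ?monicXn // monic_prod_XsubC. Qed.

Lemma size_rev_disk_poly : size V = M.+1.
Proof.
rewrite size_Mmonic ?monic_prod_XsubC ?size_polyXn ?size_prod_XsubC -?size_poly_gt0 ?size_polyXn //.
by rewrite addnS addSn subnK.
Qed.

Lemma size_disk_poly : (size A <= M.+1)%N.
Proof.
apply: leq_trans (_ : (size s).+1 <= _)%N; last by [].
rewrite /A /disk_poly; elim: (s) => [|a s' IH]; first by rewrite big_nil size_poly1.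
rewrite big_cons /= (leq_trans (size_polyMleq _ _)) //.
have : (size (1 + a *: 'X : {poly C})%R <= 2)%N.
  rewrite (leq_trans (size_polyD _ _)) // geq_max size_poly1 /=.
  by rewrite (leq_trans (size_scale_leq _ _)) // size_polyX.
move=> h2; have := leq_add h2 IH; case: (_ + _)%N => //= k; by rewrite addSn addSn ltnS.
Qed.

Lemma horner_disk_poly0 : A.[0] = 1.
Proof. by rewrite horner_disk_poly big1 // => a _; rewrite mulr0 addr0. Qed.

(** All roots of V, namely 0 and the -a, lie in the open disk, where A has no zeros. *)
Lemma coprime_disk_poly : coprimep A V.
Proof.
have A0 : ~~ root A 0 by rewrite rootE horner_disk_poly0 oner_eq0.
rewrite coprimepMr coprimep_expr ?coprimepX //=.
have : {subset s <= s} by [].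
elim: {-2}(s) => [|a s' IH] hs'; first by rewrite big_nil coprimep1.
rewrite big_cons coprimepMr IH ?andbT; last by move=> b bs; rewrite hs' // inE bs orbT.
rewrite coprimep_XsubC; apply: disk_poly_neq0 => //.
by rewrite normrN ltW // (allP hs) // hs' // inE eqxx.
Qed.

(** V = - s A would contradict coprimality, V having positive degree. *)
Lemma nodal_poly_neq0 : P != 0.
Proof.
apply/eqP => /eqP; rewrite addr_eq0 => /eqP VE.
have := coprime_disk_poly; rewrite VE -scaleNr coprimepZr ?oppr_eq0 ?signr_eq0 // coprimepp.
move=> /eqP sA; have := size_rev_disk_poly.
by rewrite VE size_polyN size_scale ?signr_eq0 // sA /M; lia.
Qed.

Lemma size_nodal_poly_leq : (size P <= M.+1)%N.
Proof.
apply: leq_trans (size_polyD _ _) _; rewrite size_rev_disk_poly geq_max leqnn /=.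
exact: leq_trans (size_scale_leq _ _) size_disk_poly.
Qed.

(** The coefficient A_j occurs in P with z^(M - j), from V, and with s z^j; each such pair is
    divisible by B through [palindrome_quotient]. *)
Lemma nodal_poly_cos : exists2 q : {poly C}, (size q <= N.+1)%N &
  forall z, z != 0 -> P.[z] = z ^+ N * (q.[(z + z^-1) / 2] * B.[z]).
Proof.
have hw (j : 'I_M.+1) : exists w : {poly C}, (size w <= N.+1)%N /\
    forall z, z != 0 -> z ^+ N * (w.[(z + z^-1) / 2] * B.[z]) =
      z ^+ (M - j) + sg * z ^+ j.
  have [|w sw hw] := @palindrome_quotient C ep em N j; first by rewrite -ltnS.
  by exists w.
have [w {}hw] := choice hw.
exists (\sum_(j < M.+1) A`_j *: w j).
  apply: leq_trans (size_sum _ _ _) _; apply/bigmax_leqP => j _.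
  by apply: leq_trans (size_scale_leq _ _) _; case: (hw j).
move=> z z0; rewrite hornerD hornerZ rev_disk_polyE //.
rewrite !(horner_coef_wide _ size_disk_poly) horner_sum mulr_suml !mulr_sumr -big_split /=.
apply: eq_bigr => j _; have [_ {}hw] := hw j.
rewrite hornerZ (_ : z ^+ N * _ = A`_j *
  (z ^+ N * ((w j).[(z + z^-1) / 2] * B.[z]))); last by ring.
rewrite hw // mulrDr mulrCA [sg * (_ * _)]mulrCA; congr (_ * _ + _).
by rewrite exprVn -exprB ?unitfE // -ltnS.
Qed.

Lemma num_poly_eixV (t : R) :
  eix t ^+ (ep + em) * B.[(eix t)^-1] = sg * B.[eix t].
Proof. by apply: num_polyV; exact: eix_neq0. Qed.

Definition disk_weight (t : R) : C :=
  B.[eix t] * B.[(eix t)^-1] / (A.[eix t] * A.[(eix t)^-1]).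

Lemma disk_weightN t : disk_weight (- t) = disk_weight t.
Proof. by rewrite /disk_weight eixN invrK [B.[_] * _]mulrC [A.[_] * _]mulrC. Qed.

Lemma disk_poly_eix_neq0 (t : R) : A.[eix t] != 0 /\ A.[(eix t)^-1] != 0.
Proof. by split; apply: disk_poly_neq0 => //; rewrite ?normc_eix ?normc_eixV. Qed.

(** The factor q B is z^-N P, and the two summands of P split the integrand into K(z)/A(z) +
    K(1/z)/A(1/z) with K = s z h B and h = z^(N-1) g(cos t). As g has degree below N, one power of z
    is left over and K(0) = 0. *)
Lemma nodal_poly_orthogonal (q g : {poly C}) : (size g <= N)%N ->
  (forall z, z != 0 -> P.[z] = z ^+ N * (q.[(z + z^-1) / 2] * B.[z])) ->
  cintegral (fun t : R => g.[(cos t)%:C] * q.[(cos t)%:C] * disk_weight t) = 0.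
Proof.
move=> sgN hq; have [|h sh hh] := @joukowski_lift C g N.-1; first by rewrite prednK.
rewrite (@cintegral_even _ s _ (sg *: ('X * h * B)) (sg *: ('X * h * B))) //.
- by rewrite !(hornerZ, hornerM, hornerX) !(mul0r, mulr0, addr0).
- by move=> t; rewrite cosN disk_weightN.
move=> t; rewrite cos_eix /disk_weight.
have [A1 A2] := disk_poly_eix_neq0 t.
have z0 := eix_neq0 t; have hB := num_poly_eixV t.
have h1 := hh _ z0; have zV0 : (eix t)^-1 != 0 by rewrite invr_eq0.
have h2 := hh _ zV0; rewrite invrK [_^-1 + _]addrC in h2.
have := hq _ z0; rewrite hornerD hornerZ rev_disk_polyE // => hP.
have hK z : (sg *: ('X * h * B)).[z] = sg * (z * h.[z] * B.[z]).
  by rewrite hornerZ 2!hornerM hornerX.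
rewrite !hK {hK}.
have -> : g.[(eix t + (eix t)^-1) / 2] * q.[(eix t + (eix t)^-1) / 2] *
    (B.[eix t] * B.[(eix t)^-1] / (A.[eix t] * A.[(eix t)^-1])) =
  g.[(eix t + (eix t)^-1) / 2] * (B.[(eix t)^-1] / (A.[eix t] * A.[(eix t)^-1])) *
    (q.[(eix t + (eix t)^-1) / 2] * B.[eix t]) by ring.
have u0 : eix t ^+ N != 0 by rewrite expf_neq0.
rewrite -[q.[_] * B.[_]](mulKf u0) -{}hP.
have zN : eix t ^+ N = eix t * eix t ^+ N.-1 by rewrite -exprS prednK.
rewrite h1 h2.
have -> : sg * (eix t * (eix t ^+ N.-1 * g.[(eix t + (eix t)^-1) / 2]) * B.[eix t])
   = eix t ^+ N * g.[(eix t + (eix t)^-1) / 2] * (sg * B.[eix t]) by rewrite zN; ring.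
have -> : sg * ((eix t)^-1 * ((eix t)^-1 ^+ N.-1 * g.[(eix t + (eix t)^-1) / 2]) *
    B.[(eix t)^-1]) = (eix t ^+ N)^-1 * g.[(eix t + (eix t)^-1) / 2] * (sg * B.[(eix t)^-1]).
  by rewrite zN invfM exprVn; ring.
rewrite -hB.
have -> : eix t ^+ M = eix t ^+ N * eix t ^+ N * eix t ^+ (ep + em).
  by rewrite -!exprD; congr (_ ^+ _); rewrite /M; lia.
move: A1 A2 u0; move: (eix t ^+ N) (eix t ^+ _) A.[_] A.[_] B.[_] g.[_] sg.
by move=> u w al al' be ga sg' A1 A2 u0; field; rewrite A1 A2 u0.
Qed.

End Nodal.

(** * Gauss quadrature at the zeros of the nodal polynomial *)

Section Quadrature.
Variables (R : realType) (s : seq R[i]) (N : nat) (ep em : bool) (xi : nat -> R).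
Local Notation C := R[i].
Hypothesis hs : all (fun a : C => `|a| < 1) s.
Let M := (2 * N + ep + em)%N.
Hypothesis hM : (size s <= M)%N.
Hypothesis hN : (0 < N)%N.
Let A := disk_poly s.
Let B := num_poly C ep em.
Let sg : C := (-1) ^+ em.
Let V := rev_disk_poly s N ep em.
Let P := nodal_poly s N ep em.
Hypothesis xi_int : forall l, (l < N)%N -> 0 < xi l < pi.
Hypothesis xi_lt : forall k l, (k < l < N)%N -> xi k < xi l.
Hypothesis xi_root : forall l, (l < N)%N -> root P (eix (xi l)).

(** The logarithmic derivative z (V'/V - A'/A) at z = [eix t], which will be identified with [hfun].
    By [hM] the subtraction of naturals is exact. *)
Definition phase_deriv (t : R) : C :=
  (M - size s)%:R + \sum_(a <- s) (1 - a ^+ 2) / ((1 + a * eix t) * (1 + a * (eix t)^-1)).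

Lemma phase_derivN t : phase_deriv (- t) = phase_deriv t.
Proof.
rewrite /phase_deriv eixN invrK; congr (_ + _); apply: eq_bigr => a _.
by rewrite [X in _ / X]mulrC.
Qed.

(* On the zeros of P = V + s A one has z P'/V = z (V'/V - A'/A). *)
Lemma deriv_nodal_poly t : root P (eix t) ->
  eix t * P^`().[eix t] = V.[eix t] * phase_deriv t.
Proof.
move=> /rootP; set z := eix t; have z0 : z != 0 := eix_neq0 t.
have z1 : `|z| = 1 := normc_eix t.
have hz a : a \in s -> 1 + a * z != 0 /\ 1 + a * z^-1 != 0.
  by move=> /(allP hs) ha; split; apply: disk_factor_neq0; rewrite // ?normfV z1 ?invr1.
have dA : z * A^`().[z] = A.[z] * \sum_(a <- s) (a * z) / (1 + a * z).
  rewrite horner_deriv_prod; last first.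
    by apply/allP => a /hz[]; rewrite !hornerE.
  rewrite mulrCA; congr (_ * _); rewrite mulr_sumr; apply: eq_bigr => a _.
  have -> : (1 + a *: 'X)^`() = a%:P.
    by rewrite derivD derivZ derivX -polyC1 derivC add0r polyC1 alg_polyC.
  by rewrite hornerC hornerD hornerC hornerZ hornerX; ring.
have dV : z * V^`().[z] = V.[z] * ((M - size s)%:R + \sum_(a <- s) (1 + a * z^-1)^-1).
  rewrite /V /rev_disk_poly derivM hornerD !hornerM horner_deriv_prod; last first.
    apply/allP => a /hz[_]; rewrite hornerXsubC opprK; apply: contra => /eqP h.
    by rewrite -(mulfV z0) -mulrDl h mul0r.
  rewrite derivXn hornerMn !hornerXn [LHS]mulrDr [RHS]mulrDr; congr (_ + _).
    rewrite -mulr_natr; case: (M - size s)%N => [|k]; first by rewrite !mulr0 !mul0r mulr0.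
    by rewrite exprS /=; ring.
  rewrite -!mulrA [LHS]mulrCA; congr (_ * _); rewrite [LHS]mulrCA; congr (_ * _).
  rewrite mulr_sumr; apply: eq_big_seq => a /hz[_ ha].
  rewrite derivXsubC hornerXsubC hornerC opprK.
  have -> : z + a = z * (1 + a * z^-1) by field.
  by rewrite mul1r invfM mulVKf.
rewrite /P /nodal_poly hornerD hornerZ => /eqP; rewrite addr_eq0 -/V -/A -/sg => /eqP VA.
rewrite derivD derivZ hornerD hornerZ mulrDr dV mulrCA dA mulrA.
have -> : sg * A.[z] = - V.[z] by rewrite VA opprK.
rewrite mulNr -mulrBr; congr (_ * _); rewrite /phase_deriv -addrA; congr (_ + _).
rewrite -sumrB; apply: eq_big_seq => a /hz[h1 h2].
rewrite -/z; field; rewrite h1 /= z0 andbT.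
by apply: contra h2 => /eqP h; rewrite -(mulfV z0) -mulrDl h mul0r.
Qed.

(** Passing from z to 1/z exchanges V and A up to a power of z, so the nonzero roots of P are closed
    under inversion. *)
Lemma nodal_polyV z : z != 0 -> z ^+ M * P.[z^-1] = sg * P.[z].
Proof.
move=> z0; rewrite /P /nodal_poly !hornerD !hornerZ !rev_disk_polyE ?invr_eq0 // invrK.
rewrite -/A -/M -/sg !mulrDr exprVn mulVKf ?expf_neq0 //.
by rewrite [sg * (sg * _)]mulrA -expr2 sqrr_sign mul1r addrC mulrCA.
Qed.

(** The blocks [nseq ep] and [nseq em] insert the zeros -1 and 1 of B, each exactly when its boolean
    is true. *)
Definition circle_nodes : seq C :=
  [seq eix (xi l) | l <- iota 0 N] ++ [seq (eix (xi l))^-1 | l <- iota 0 N] ++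
  nseq ep (-1) ++ nseq em 1.

Lemma size_circle_nodes : size circle_nodes = M.
Proof. by rewrite !size_cat !size_map size_iota !size_nseq /M; lia. Qed.

Lemma circle_nodes_root : all (root P) circle_nodes.
Proof.
have [q _ hq] := nodal_poly_cos (hM : (size s <= 2 * N + ep + em)%N).
rewrite !all_cat; apply/and4P; split.
- by apply/allP => _ /mapP[l + ->]; rewrite mem_iota => /xi_root.
- apply/allP => _ /mapP[l + ->]; rewrite mem_iota => /xi_root /rootP h.
  have := nodal_polyV (eix_neq0 (xi l)); rewrite h mulr0 => /eqP.
  by rewrite mulf_eq0 expf_eq0 (negbTE (eix_neq0 _)) andbF.
- rewrite all_nseq; apply/orP; case epE : ep; [right | by left].
  rewrite rootE hq ?oppr_eq0 ?oner_eq0 // horner_num_poly epE.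
  by rewrite mul1r subrr mul0r !mulr0.
- rewrite all_nseq; apply/orP; case emE : em; [right | by left].
  by rewrite rootE hq ?oner_eq0 // horner_num_poly emE mul1r subrr !mulr0.
Qed.

Lemma Im_eix (t : R) : complex.Im (eix t) = sin t. Proof. by []. Qed.

Lemma Im_eixV (t : R) : complex.Im (eix t)^-1 = - sin t.
Proof. by rewrite -eixN Im_eix sinN. Qed.

Lemma cos_xi_inj k l : (k < N)%N -> (l < N)%N -> cos (xi k) = cos (xi l) -> k = l.
Proof.
move=> kN lN h; have xI j : (j < N)%N -> xi j \in `[0, pi].
  by move=> /xi_int /andP[? ?]; rewrite in_itv /= !ltW.
have {}h : xi k = xi l by apply: cos_inj => //; exact: xI.
by case: (ltngtP k l) => // kl; [have := @xi_lt k l | have := @xi_lt l k];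
  rewrite kl ?kN ?lN h ltxx => /(_ isT).
Qed.

(** The blocks are told apart by the sign of the imaginary part: positive, negative, zero. *)
Lemma circle_nodes_uniq : uniq circle_nodes.
Proof.
have sp l : (l < N)%N -> 0 < sin (xi l) by move=> /xi_int /sin_gt0_pi.
rewrite !cat_uniq !map_inj_in_uniq ?iota_uniq /=; first last.
- move=> k l; rewrite !mem_iota /= => kN lN h; apply: cos_xi_inj => //.
  by case: h.
- move=> k l; rewrite !mem_iota /= => kN lN /invr_inj h; apply: cos_xi_inj => //.
  by case: h.
have u2 : uniq (nseq ep (-1 : C) ++ nseq em 1).
  case: ep; case: em => //=; rewrite inE andbT -subr_eq0 -opprD oppr_eq0.
  by rewrite (_ : 1 + 1 = 2%:R) // pnatr_eq0.
have im0 : {in nseq ep (-1 : C) ++ nseq em 1, forall z, complex.Im z = 0}.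
  by move=> z; rewrite mem_cat => /orP[] /nseqP[-> _] /=; rewrite ?oppr0.
rewrite -cat_uniq u2 andbT; apply/andP; split.
- apply/hasPn => z; rewrite mem_cat => /orP[].
    move=> /mapP[l]; rewrite mem_iota /= => lN ->; apply/mapP => -[k].
    rewrite mem_iota /= => kN /(congr1 (@complex.Im R)); rewrite Im_eixV Im_eix => h.
    by have := sp _ kN; rewrite -h oppr_gt0 ltNge ltW ?sp.
  move=> /im0 h; apply/mapP => -[k]; rewrite mem_iota /= => kN zE.
  by have := sp _ kN; rewrite -Im_eix -zE h ltxx.
- apply/hasPn => z /im0 h; apply/mapP => -[k]; rewrite mem_iota /= => kN zE.
  by have := sp _ kN; rewrite -oppr_lt0 -Im_eixV -zE h ltxx.
Qed.

(** P is nonzero with M distinct roots, so the leading terms of V and s A cannot cancel. *)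
Lemma size_nodal_poly : size P = M.+1.
Proof.
apply/eqP; rewrite eqn_leq size_nodal_poly_leq //= ltnNge -size_circle_nodes.
apply/negP => h; have := @nodal_poly_neq0 _ s N ep em hs hM hN; rewrite -/P.
by rewrite (roots_geq_poly_eq0 circle_nodes_root circle_nodes_uniq h) eqxx.
Qed.

Lemma sum_circle_nodes (F : C -> C) : (ep -> F (-1) = 0) -> (em -> F 1 = 0) ->
  \sum_(z <- circle_nodes) F z = \sum_(l < N) (F (eix (xi l)) + F (eix (xi l))^-1).
Proof.
move=> F1 F2; rewrite !big_cat /= !big_map -{1 2}[N]subn0 -/(index_iota 0 N).
rewrite !big_mkord big_split /=; congr (_ + _).
rewrite [X in _ + X = _](_ : _ = 0) ?addr0 //.
case: ep F1 => [/(_ isT) F1|_]; case: em F2 => [/(_ isT) F2|_] /=;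
  by rewrite ?big_cons ?big_nil ?F1 ?F2 ?addr0.
Qed.

Lemma nodal_quadrature (g : {poly C}) : (size g <= 2 * N)%N ->
  cintegral (fun t : R => g.[(cos t)%:C] * disk_weight s ep em t) =
  (2 * pi)%:C * \sum_(l < N)
    g.[(cos (xi l))%:C] * disk_weight s ep em (xi l) / phase_deriv (xi l).
Proof.
move=> sgN; have M0 : (0 < M)%N by rewrite /M; lia.
have [|h sh hh] := @joukowski_lift C g (2 * N).-1; first by rewrite prednK //; lia.
(* On the circle U is z^(M-1) g B(z) B(1/z): here h = z^(2N-1) g, and s B = z^(ep+em) B(1/z)
   supplies the rest of the power. *)
pose U := sg *: (h * B ^+ 2).
have hU t : eix t * U.[eix t] =
    eix t ^+ M * (g.[(cos t)%:C] * (B.[eix t] * B.[(eix t)^-1])).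
  rewrite /U hornerZ hornerM (hh _ (eix_neq0 t)) -cos_eix horner_exp.
  have hB : eix t ^+ (ep + em) * B.[(eix t)^-1] = sg * B.[eix t].
    exact: (num_poly_eixV ep em t).
  have -> : eix t ^+ M = eix t * eix t ^+ (2 * N).-1 * eix t ^+ (ep + em).
    by rewrite -exprS -exprD; congr (_ ^+ _); rewrite /M; lia.
  rewrite (_ : _ * (g.[_] * _) = eix t * eix t ^+ (2 * N).-1 * g.[(cos t)%:C] * B.[eix t] *
     (eix t ^+ (ep + em) * B.[(eix t)^-1])); last by ring.
  by rewrite hB; ring.
have sB : (size B <= (ep + em).+1)%N.
  rewrite /B /num_poly (leq_trans (size_polyMleq _ _)) //.
  have lin (b : bool) (c : C) : (size (1 + (c * b%:R) *: 'X : {poly C})%R <= b.+1)%N.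
    rewrite (leq_trans (size_polyD _ _)) // geq_max size_poly1 /=.
    case: b; rewrite ?mulr0 ?scale0r ?size_poly0 //.
    by rewrite (leq_trans (size_scale_leq _ _)) // size_polyX.
  have := leq_add (lin ep 1) (lin em (-1)); rewrite mul1r mulN1r scaleNr => H.
  by rewrite -subn1 (leq_trans (leq_sub2r 1 H)) //; lia.
have sU : (size U <= (2 * M).-1)%N.
  rewrite /U (leq_trans (size_scale_leq _ _)) // (leq_trans (size_polyMleq _ _)) //.
  have sB2 : (size (B ^+ 2) <= ((ep + em) * 2).+1)%N.
    by rewrite (leq_trans (size_poly_exp_leq _ _)) // ltnS leq_mul2r; move: sB; case: (size B).
  by rewrite -subn1 (leq_trans (leq_sub2r 1 (leq_add sh sB2))) // /M; lia.
have V0 : V != 0 by rewrite monic_neq0 ?monic_rev_disk_poly.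
have [[X Y] /= UE] := bezout_split U (coprime_disk_poly N ep em hs) V0.
rewrite /V size_rev_disk_poly // ltnS => sX.
have sA : (size A <= M.+1)%N by exact: size_disk_poly.
(* Y V = U - X A has degree at most 2M - 1, and V is monic of degree M. *)
have sY : (size Y <= M)%N.
  have [->|Y0] := eqVneq Y 0; first by rewrite size_poly0.
  have : (size (Y * V)%R <= 2 * M)%N.
    rewrite (_ : Y * V = U - X * A); last by rewrite UE addrC addKr.
    rewrite (leq_trans (size_polyD _ _)) // geq_max size_polyN.
    apply/andP; split; first by rewrite (leq_trans sU) //; lia.
    rewrite (leq_trans (size_polyMleq X A)) // -subn1.
    by rewrite (leq_trans (leq_sub2r 1 (leq_add sX sA))) // /M; lia.
  rewrite size_Mmonic ?monic_rev_disk_poly // size_rev_disk_poly // addnS /= -/M.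
  by rewrite mul2n -addnn leq_add2r.
(* The coefficient of z^(2M-1) in U = X A + Y V, a power that U does not reach. *)
have YX : Y`_M.-1 = - (X`_M.-1 * A`_M).
  have : U`_(M.-1 + M) = 0 by rewrite nth_default // (leq_trans sU) //; lia.
  have e1 : (X * A)`_(M.-1 + M) = X`_M.-1 * A`_M.
    by apply: (@coefM_top _ X A M.-1 M); rewrite ?prednK.
  have e2 : (Y * V)`_(M.-1 + M) = Y`_M.-1 * V`_M.
    apply: (@coefM_top _ Y V M.-1 M); first by rewrite prednK.
    by rewrite /V size_rev_disk_poly.
  have V1 : V`_M = 1.
    by have /monicP := monic_rev_disk_poly s N ep em; rewrite lead_coefE size_rev_disk_poly.
  rewrite UE coefD -/A -/V e1 e2 V1.
  by rewrite mulr1 addrC => /eqP; rewrite addr_eq0 => /eqP.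
have lP : lead_coef P = 1 + sg * A`_M.
  rewrite lead_coefE size_nodal_poly /= coefD coefZ; congr (_ + _).
  by have /monicP := monic_rev_disk_poly s N ep em; rewrite lead_coefE size_rev_disk_poly.
have lP0 : lead_coef P != 0 by rewrite lead_coef_eq0 -size_poly_eq0 size_nodal_poly.
(* At a zero of P one has V = - s A, hence U = A Q. *)
pose Q := X - sg *: Y.
have sQ : (size Q <= M)%N.
  rewrite (leq_trans (size_polyD _ _)) // geq_max sX size_polyN.
  exact: leq_trans (size_scale_leq _ _) sY.
(* The coefficient of z^(M-1) in Q is X_(M-1) (1 + s A_M), whose second factor is the leading
   coefficient of P. *)
have res : \sum_(z <- circle_nodes) Q.[z] / P^`().[z] = X`_M.-1.
  have := sum_residue (Q := Q) circle_nodes_uniq circle_nodes_root.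
  rewrite size_circle_nodes => /(_ size_nodal_poly sQ).
  rewrite coefB coefZ YX (_ : _ - _ = lead_coef P * X`_M.-1); last by rewrite lP; ring.
  exact: mulfI.
have UEz z : U.[z] = X.[z] * A.[z] + Y.[z] * V.[z].
  by rewrite UE hornerD; congr (_ + _); exact: hornerM.
have rootU z : root P z -> U.[z] = A.[z] * Q.[z].
  rewrite rootE hornerD hornerZ addr_eq0 => /eqP VA.
  rewrite UEz (VA : V.[z] = _) /Q hornerD hornerN hornerZ -/A -/sg; ring.
have A_neq0 z : `|z| = 1 -> A.[z] != 0.
  by move=> z1; apply: disk_poly_neq0; rewrite ?z1.
(* In the quotient of z A Q = z U by z P' = V h the powers z^M cancel, leaving the weight over h. *)
have term t : root P (eix t) -> Q.[eix t] / P^`().[eix t] =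
    g.[(cos t)%:C] * disk_weight s ep em t / phase_deriv t.
  move=> rt; have z0 := eix_neq0 t.
  have A1 : A.[eix t] != 0 by rewrite A_neq0 ?normc_eix.
  have A2 : A.[(eix t)^-1] != 0 by rewrite A_neq0 ?normc_eixV.
  have := hU t; rewrite rootU // => hQ.
  have := deriv_nodal_poly rt; rewrite /V rev_disk_polyE // -/A => hP.
  have zM : eix t ^+ M != 0 by rewrite expf_neq0.
  have -> : Q.[eix t] = eix t ^+ M * (g.[(cos t)%:C] * (B.[eix t] * B.[(eix t)^-1]))
       / (eix t * A.[eix t]).
    by rewrite -hQ mulrA mulrC mulKf // mulf_neq0.
  have -> : P^`().[eix t] = eix t ^+ M * A.[(eix t)^-1] * phase_deriv t / eix t.
    by rewrite -hP mulrC mulKf.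
  (* If [phase_deriv t] is zero, so is P' at the node, and both sides are zero by the convention x /
     0 = 0. *)
  rewrite /disk_weight -/A -/B; have [->|ph] := eqVneq (phase_deriv t) 0.
    by rewrite mulr0 mul0r invr0 !mulr0.
  by field; rewrite A1 A2 z0 zM ph.
(* B^2 divides U, so Q vanishes at those zeros of B and they carry no weight. *)
have Bz z : root P z -> A.[z] != 0 -> B.[z] = 0 -> Q.[z] / P^`().[z] = 0.
  move=> rz Az Bz; have := rootU z rz; rewrite /U hornerZ hornerM horner_exp Bz.
  rewrite expr0n /= !mulr0 => /esym /eqP; rewrite mulf_eq0 (negbTE Az) /= => /eqP ->.
  by rewrite mul0r.
rewrite sum_circle_nodes in res; first last.
- move=> em1; apply: Bz.
  + by apply: (allP circle_nodes_root); rewrite !mem_cat em1 mem_seq1 eqxx !orbT.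
  + by rewrite A_neq0 ?normr1.
  + by rewrite horner_num_poly em1 !mulr1 subrr mulr0.
- move=> ep1; apply: Bz.
  + by apply: (allP circle_nodes_root); rewrite !mem_cat ep1 mem_seq1 eqxx !orbT.
  + by rewrite A_neq0 ?normrN1.
  + by rewrite horner_num_poly ep1 mul1r subrr mul0r.
(* The integrand is z Y / A plus z X / V = K(1/z)/A(1/z), with K the reversal of X; K(0) is the
   coefficient of z^(M-1) in X. *)
rewrite (@cintegral_even _ s _ ('X * Y) (\poly_(i < M) X`_(M.-1 - i))) //; first last.
- move=> t; have z0 := eix_neq0 t.
  have A1 : A.[eix t] != 0 by rewrite A_neq0 ?normc_eix.
  have A2 : A.[(eix t)^-1] != 0 by rewrite A_neq0 ?normc_eixV.
  have := hU t; rewrite UEz rev_disk_polyE // -/A.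
  rewrite -(horner_revV z0 sX) [('X * Y).[_]]hornerM hornerX.
  have -> : eix t ^+ M = eix t * eix t ^+ M.-1 by rewrite -exprS prednK.
  rewrite /disk_weight -/A -/B => E.
  have u0 : eix t ^+ M.-1 != 0 by rewrite expf_neq0.
  apply: (mulfI (mulf_neq0 z0 u0)); rewrite mulrA -[RHS]/(_ * _) /=.
  rewrite [LHS](_ : _ = eix t * eix t ^+ M.-1 * (g.[(cos t)%:C] *
     (B.[eix t] * B.[(eix t)^-1])) / (A.[eix t] * A.[(eix t)^-1])); last by ring.
  by rewrite -E; field; rewrite A1 A2.
- by move=> t; rewrite cosN disk_weightN.
rewrite hornerM hornerX mul0r add0r horner_coef0 coef_poly M0 subn0 -res.
(* A node and its inverse give equal terms, which accounts for 2 pi in place of pi. *)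
rewrite [(2 * pi)%:C]rmorphM /= rmorph_nat -mulrA mulrCA; congr (_ * _).
rewrite mulr_sumr; apply: eq_bigr => l _; have rl := xi_root (ltn_ord l).
rewrite term // -eixN term; first by rewrite cosN disk_weightN phase_derivN; ring.
apply: (allP circle_nodes_root); rewrite eixN !mem_cat; apply/orP; right; apply/orP; left.
by apply/mapP; exists (l : nat); rewrite ?mem_iota /=.
Qed.

End Quadrature.

Lemma poly_basis (F : fieldType) (b : nat -> {poly F}) (q : {poly F}) k :
  (forall l, size (b l) = l.+1) -> (size q <= k)%N ->
  exists c : nat -> F, q = \sum_(l < k) c l *: b l.
Proof.
move=> sb; elim: k q => [|k IH] q sq.
  by exists (fun=> 0); rewrite big_ord0; apply/eqP; rewrite -size_poly_leq0.
pose e := q`_k / lead_coef (b k).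
have lb : lead_coef (b k) != 0 by rewrite lead_coef_eq0 -size_poly_eq0 sb.
have [|c hc] := IH (q - e *: b k).
  apply/leq_sizeP => j; rewrite leq_eqVlt => /orP[/eqP <-|kj].
    have lE : lead_coef (b k) = (b k)`_k by rewrite lead_coefE sb.
    by rewrite coefB coefZ -lE divfK ?subrr.
  rewrite coefB coefZ !nth_default ?mulr0 ?subr0 //; last exact: leq_trans sq kj.
  by rewrite sb.
exists (fun l => if l == k then e else c l).
rewrite big_ord_recr /= eqxx -[LHS](subrK (e *: b k)) hc; congr (_ + _).
by apply: eq_bigr => l _; rewrite ltn_eqF.
Qed.

(** * Bernstein-Szego polynomials and their Gauss quadrature *)

Section Gauss.
Variables (R : realType) (N d : nat) (ep em : bool) (a : 'I_d -> R[i]).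
Local Notation C := R[i].
Local Notation s := (codom a).

Lemma bs_factorE r (t : R) :
  bs_factor a r t = (1 + a r * eix t) * (1 + a r * (eix t)^-1).
Proof. by have z0 := eix_neq0 t; rewrite /bs_factor cos_eix; field. Qed.

Lemma prod_bs_factor (t : R) :
  \prod_(r < d) bs_factor a r t = (disk_poly s).[eix t] * (disk_poly s).[(eix t)^-1].
Proof.
rewrite !horner_disk_poly !big_image -big_split /=.
by apply: eq_bigr => r _; exact: bs_factorE.
Qed.

Lemma bs_numeratorE (t : R) : (bs_numerator ep em t)%:C =
  (num_poly C ep em).[eix t] * (num_poly C ep em).[(eix t)^-1].
Proof.
rewrite /bs_numerator !horner_num_poly !rmorphM rmorphXn rmorph_nat rmorphD rmorphB /=.
rewrite !rmorphM /= !rmorph_nat rmorph1 cos_eix; have z0 := eix_neq0 t.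
by case: ep; case: em => /=; field.
Qed.

Lemma disk_weightE (t : R) : disk_weight s ep em t =
  (bs_numerator ep em t)%:C / \prod_(r < d) bs_factor a r t.
Proof. by rewrite /disk_weight prod_bs_factor bs_numeratorE. Qed.

Lemma bs_weightE (t : R) :
  bs_weight ep em a t = (2 * pi)%:C^-1 * disk_weight s ep em t.
Proof. by rewrite disk_weightE /bs_weight invfM mulrCA. Qed.

Hypothesis hN : (0 < N)%N.
Hypothesis ha : forall r, `|a r| < 1.
Hypothesis hd : (d <= 2 * N + ep + em)%N.

Lemma codom_lt1 : all (fun a : C => `|a| < 1) s.
Proof. by apply/allP => _ /codomP[r ->]; exact: ha. Qed.

Lemma size_codom_le : (size s <= 2 * N + ep + em)%N.
Proof. by rewrite size_codom card_ord. Qed.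

Lemma hfunE (t : R) : hfun ep em a N t = phase_deriv s N ep em t.
Proof.
rewrite /hfun /phase_deriv size_codom card_ord natrB // !natrD big_image /=.
congr (_ + _); first by ring.
by apply: eq_bigr => r _; rewrite bs_factorE.
Qed.

Lemma ccontinuous_disk_weight : ccontinuous (disk_weight s ep em).
Proof.
have [c1 _] := ccontinuous_circle_frac (num_poly C ep em) codom_lt1.
have [_ c2] := ccontinuous_circle_frac (num_poly C ep em) codom_lt1.
have := ccontinuousM c1 c2; congr ccontinuous; apply: funext => t.
by rewrite /disk_weight invfM mulrACA.
Qed.

Variables (p : nat -> {poly R}) (xi : nat -> R).
Hypothesis hp : is_bs_polys ep em a p.
Hypothesis hxi : is_bs_angles p N xi.

(** The quotient q, of degree at most N, is expanded in the p_k. Orthogonality kills the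
    coefficients below N, so q is a multiple of p_N and vanishes at the cosines of the angles. *)
Lemma nodal_poly_bs_root l : (l < N)%N -> root (nodal_poly s N ep em) (eix (xi l)).
Proof.
move=> lN; have [q sq hq] := nodal_poly_cos size_codom_le.
have [sp lp op] := hp; have [_ _ rp] := hxi.
pose b k := map_poly (real_complex R) (p k).
have sb k : size (b k) = k.+1 by rewrite size_map_poly sp.
have bE k x : (b k).[x%:C] = (p k).[x]%:C by rewrite horner_map.
have [c qE] := poly_basis sb sq.
have pi0 : (2 * pi)%:C != 0 :> C.
  by rewrite fmorph_eq0 mulf_neq0 // ?pnatr_eq0 // gt_eqF // pi_gt0.
have c0 k : (k < N)%N -> c k = 0.
  move=> kN; have := nodal_poly_orthogonal codom_lt1 size_codom_le hN (g := b k) _ hq.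
  rewrite sb => /(_ kN) => E.
  suff : cintegral (fun t : R => (b k).[(cos t)%:C] * q.[(cos t)%:C] *
      disk_weight s ep em t) = c k * (2 * pi)%:C.
    by rewrite E => /esym/eqP; rewrite mulf_eq0 (negbTE pi0) orbF => /eqP.
  have cw (j : nat) : ccontinuous (fun t =>
      ((p k).[cos t] * (p j).[cos t])%:C * bs_weight ep em a t).
    apply: ccontinuousM; last first.
      rewrite (_ : bs_weight _ _ _ = fun t => (2 * pi)%:C^-1 * disk_weight s ep em t).
        by apply: ccontinuousM; [exact: ccontinuous_cst | exact: ccontinuous_disk_weight].
      by apply: funext => t; rewrite bs_weightE.
    rewrite (_ : (fun _ => _) = fun t => (b k * b j).[(cos t)%:C]).
      by apply: ccontinuous_horner; exact: ccontinuous_cos.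
    by apply: funext => t; rewrite hornerM !bE rmorphM.
  (* The factor 2 pi compensates the 1/(2 pi) in [bs_weight]. *)
  transitivity (cintegral (fun t : R => \sum_(j < N.+1) (c j * (2 * pi)%:C) *
      (((p k).[cos t] * (p j).[cos t])%:C * bs_weight ep em a t))).
    congr cintegral; apply: funext => t.
    rewrite [in LHS]qE horner_sum mulr_sumr mulr_suml; apply: eq_bigr => j _.
    rewrite hornerZ !bE bs_weightE [(_ * (p j).[_])%:C]rmorphM /=.
    by move: (2 * pi)%:C pi0 => w w0; field.
  rewrite cintegral_sum; last first.
    by move=> j; apply: ccontinuousM; [exact: ccontinuous_cst | exact: cw].
  under eq_bigr do rewrite cintegralZ // op.
  have kN1 : (k < N.+1)%N by rewrite ltnW.
  rewrite (bigD1 (Ordinal kN1)) //= eqxx mulr1 big1 ?addr0 // => j.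
  by rewrite -val_eqE /= eq_sym => /negbTE ->; rewrite mulr0.
rewrite rootE hq ?eix_neq0 // -cos_eix qE big_ord_recr /= big1 => [|j _].
  by rewrite add0r hornerZ bE (rootP (rp l lN)) mulr0 mul0r mulr0.
by rewrite c0 // scale0r.
Qed.

Lemma bs_gauss_quadrature (g : {poly C}) : (size g <= 2 * N)%N ->
  cintegral (fun t : R => g.[(cos t)%:C] *
    ((bs_numerator ep em t)%:C / \prod_(r < d) bs_factor a r t)) =
  (2 * pi)%:C * \sum_(l < N) g.[(cos (xi l))%:C] *
    ((bs_numerator ep em (xi l))%:C / \prod_(r < d) bs_factor a r (xi l)) /
    hfun ep em a N (xi l).
Proof.
move=> sg; have [h1 h2 _] := hxi.
have := nodal_quadrature codom_lt1 size_codom_le hN h1 h2 nodal_poly_bs_root sg.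
under [X in cintegral X = _]eq_fun do rewrite disk_weightE.
by under [X in _ = _ * X]eq_bigr do rewrite disk_weightE -hfunE.
Qed.

End Gauss.

(** * Iterated quadrature *)

Section IteratedGauss.
Variable R : realType.
Local Notation C := R[i].

Definition upd n (t : n.-tuple R) (j : 'I_n) (x : R) : n.-tuple R :=
  [tuple if i == j then x else tnth t i | i < n].

Lemma tnth_upd n (t : n.-tuple R) j x i :
  tnth (upd t j x) i = if i == j then x else tnth t i.
Proof. by rewrite tnth_mktuple. Qed.

Lemma upd_cons0 n (t : n.-tuple R) y x :
  upd (cons_tuple y t) ord0 x = cons_tuple x t.
Proof.
apply: eq_from_tnth => i; rewrite tnth_upd.
case: (unliftP ord0 i) => [k ->|->]; last by rewrite eqxx !tnth0.
by rewrite eq_sym (negbTE (neq_lift _ _)) !tnthS.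
Qed.

Lemma upd_consS n (t : n.-tuple R) j y x :
  upd (cons_tuple y t) (lift ord0 j) x = cons_tuple y (upd t j x).
Proof.
apply: eq_from_tnth => i; rewrite tnth_upd.
case: (unliftP ord0 i) => [k ->|->]; last by rewrite (negbTE (neq_lift _ _)) !tnth0.
by rewrite (inj_eq (@lift_inj _ _)) !tnthS tnth_upd.
Qed.

(** The other coordinates are frozen and q may depend on them: the quadrature is applied to one
    variable at a time. *)
Definition cos_poly_in n (D : nat) (j : 'I_n) (g : n.-tuple R -> C) : Prop :=
  forall t, exists2 q : {poly C}, (size q <= D.+1)%N
    & forall x, g (upd t j x) = q.[(cos x)%:C].

Lemma cos_poly_in_cst n (j : 'I_n) (c : C) : cos_poly_in 0 j (fun=> c).
Proof.
by move=> t; exists c%:P => [|x]; rewrite ?hornerC // size_polyC_leq1.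
Qed.

Lemma cos_poly_in_leq n D D' (j : 'I_n) g : (D <= D')%N ->
  cos_poly_in D j g -> cos_poly_in D' j g.
Proof.
by move=> DD hg t; have [q sq hq] := hg t; exists q => //; rewrite (leq_trans sq).
Qed.

Lemma cos_poly_in_cos n (i j : 'I_n) :
  cos_poly_in (i == j) j (fun t => (cos (tnth t i))%:C).
Proof.
move=> t; have [ij|ij] := eqVneq i j.
  by exists 'X => [|x]; rewrite ?size_polyX // tnth_upd ij eqxx hornerX.
exists (cos (tnth t i))%:C%:P => [|x]; first by rewrite size_polyC_leq1.
by rewrite tnth_upd (negbTE ij) hornerC.
Qed.

Lemma cos_poly_inD n D (j : 'I_n) g1 g2 : cos_poly_in D j g1 ->
  cos_poly_in D j g2 -> cos_poly_in D j (fun t => g1 t + g2 t).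
Proof.
move=> h1 h2 t; have [q1 s1 e1] := h1 t; have [q2 s2 e2] := h2 t.
exists (q1 + q2) => [|x]; last by rewrite hornerD e1 e2.
by rewrite (leq_trans (size_polyD _ _)) // geq_max s1.
Qed.

Lemma cos_poly_inM n D1 D2 (j : 'I_n) g1 g2 : cos_poly_in D1 j g1 ->
  cos_poly_in D2 j g2 -> cos_poly_in (D1 + D2) j (fun t => g1 t * g2 t).
Proof.
move=> h1 h2 t; have [q1 s1 e1] := h1 t; have [q2 s2 e2] := h2 t.
exists (q1 * q2) => [|x]; last by rewrite hornerM e1 e2.
rewrite (leq_trans (size_polyMleq _ _)) // -subn1.
by rewrite (leq_trans (leq_sub2r 1 (leq_add s1 s2))) //; lia.
Qed.

Lemma cos_poly_inX n D (j : 'I_n) g k : cos_poly_in D j g ->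
  cos_poly_in (D * k) j (fun t => g t ^+ k).
Proof.
move=> hg; elim: k => [|k IH]; first by rewrite muln0; exact: cos_poly_in_cst.
rewrite mulnS (_ : (fun _ => _) = fun t => g t * g t ^+ k); first exact: cos_poly_inM.
by apply: funext => t; rewrite exprS.
Qed.

Lemma cos_poly_in_sum n (I : Type) (r : seq I) D (j : 'I_n)
    (g : I -> n.-tuple R -> C) :
  (forall i, cos_poly_in D j (g i)) ->
  cos_poly_in D j (fun t => \sum_(i <- r) g i t).
Proof.
move=> hg; elim: r => [|i r IH].
  rewrite (_ : (fun _ => _) = fun=> 0).
    by apply: cos_poly_in_leq (cos_poly_in_cst _ _).
  by apply: funext => t; rewrite big_nil.
rewrite (_ : (fun _ => _) = fun t => g i t + \sum_(i0 <- r) g i0 t).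
  by apply: cos_poly_inD => //; exact: hg.
by apply: funext => t; rewrite big_cons.
Qed.

Lemma cos_poly_in_prod n (I : Type) (r : seq I) (P : pred I) (D : I -> nat) (j : 'I_n)
    (g : I -> n.-tuple R -> C) :
  (forall i, P i -> cos_poly_in (D i) j (g i)) ->
  cos_poly_in (\sum_(i <- r | P i) D i) j (fun t => \prod_(i <- r | P i) g i t).
Proof.
move=> hg; elim: r => [|i r IH].
  rewrite big_nil (_ : (fun _ => _) = fun=> 1); first exact: cos_poly_in_cst.
  by apply: funext => t; rewrite big_nil.
have [Pi|nPi] := boolP (P i).
  rewrite big_cons Pi (_ : (fun _ => _) = fun t => g i t * \prod_(k <- r | P k) g k t).
    by apply: cos_poly_inM => //; exact: hg.
  by apply: funext => t; rewrite big_cons Pi.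
rewrite big_cons (negbTE nPi) (_ : (fun _ => _) = fun t => \prod_(k <- r | P k) g k t) //.
by apply: funext => t; rewrite big_cons (negbTE nPi).
Qed.

Lemma cos_poly_in_meval n (f : mpoly.mpoly n C) D (j : 'I_n) :
  mpoly_partial_degree_le f D ->
  cos_poly_in D j (fun t => mpoly.meval (fun i => (cos (tnth t i))%:C) f).
Proof.
move=> fD; rewrite (_ : (fun _ => _) = fun t => \sum_(mon <- mpoly.msupp f)
    mpoly.mcoeff mon f * \prod_(i < n) (cos (tnth t i))%:C ^+ mpoly.fun_of_multinom mon i).
  apply: (@cos_poly_in_sum n _ (mpoly.msupp f) D j (fun mon t => mpoly.mcoeff mon f *
    \prod_(i < n) (cos (tnth t i))%:C ^+ mpoly.fun_of_multinom mon i)) => mon.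
  have [->|hmon] := eqVneq (mpoly.mcoeff mon f) 0.
    rewrite (_ : (fun _ => _) = fun=> 0); first exact: cos_poly_in_leq (cos_poly_in_cst _ _).
    by apply: funext => t; rewrite mul0r.
  apply: (cos_poly_in_leq (fD _ hmon j)); rewrite -[X in cos_poly_in X]add0n.
  apply: cos_poly_inM; first exact: cos_poly_in_cst.
  have -> : mpoly.fun_of_multinom mon j =
      (\sum_(i < n) (i == j) * mpoly.fun_of_multinom mon i)%N.
    rewrite (bigD1 j) //= eqxx mul1n big1 ?addn0 // => i /negbTE ->.
    by rewrite mul0n.
  by apply: cos_poly_in_prod => i _; apply: cos_poly_inX; exact: cos_poly_in_cos.
by apply: funext => t; rewrite mpoly.mevalE.
Qed.

(** The coordinate i occurs in n - 1 of the differences, each squared. *)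
Lemma cos_poly_in_vandermonde n (i : 'I_n) : cos_poly_in (2 * n.-1) i
  (fun t => (\prod_(j < n) \prod_(k < n | (j < k)%N)
     (cos (tnth t j) - cos (tnth t k)) ^+ 2)%:C).
Proof.
rewrite (_ : (fun _ => _) = fun t => \prod_(j < n) \prod_(k < n | (j < k)%N)
   ((cos (tnth t j))%:C + - 1 * (cos (tnth t k))%:C) ^+ 2); last first.
  apply: funext => t; rewrite rmorph_prod; apply: eq_bigr => j _.
  rewrite rmorph_prod; apply: eq_bigr => k _.
  by rewrite rmorphXn rmorphB mulN1r.
have -> : (2 * n.-1 = \sum_(j < n) \sum_(k < n | (j < k)%N) ((j == i) + (k == i)) * 2)%N.
  transitivity ((\sum_(j < n) \sum_(k < n | (j < k)%N) ((j == i) + (k == i))) * 2)%N.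
    rewrite mulnC; congr (_ * _)%N.
    under eq_bigr do rewrite big_split /=.
    rewrite big_split /=.
    have -> : (\sum_(j < n) \sum_(k < n | (j < k)%N) (j == i) = \sum_(k < n | (i < k)%N) 1)%N.
      rewrite (bigD1 i) //= eqxx [X in (_ + X)%N]big1 ?addn0 // => j /negbTE ->.
      by rewrite big1.
    have -> : (\sum_(j < n) \sum_(k < n | (j < k)%N) (k == i) = \sum_(j < n | (j < i)%N) 1)%N.
      rewrite (exchange_big_dep predT) //= (bigD1 i) //= eqxx.
      by rewrite [X in (_ + X)%N]big1 ?addn0 // => j /negbTE ->; rewrite big1.
    (* The indices above i and those below i are together the n - 1 indices other than i. *)
    rewrite addnC; have := cardC1 i; rewrite card_ord => <-.
    rewrite -sum1_card (bigID (fun k : 'I_n => (k < i)%N)) /=.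
    by congr (_ + _)%N; apply: eq_bigl => k; rewrite !inE -val_eqE /=; case: ltngtP.
  rewrite big_distrl /=; apply: eq_bigr => j _.
  by rewrite big_distrl.
apply: cos_poly_in_prod => j _; apply: cos_poly_in_prod => k jk.
apply: cos_poly_inX; apply: cos_poly_inD.
  by apply: cos_poly_in_leq (cos_poly_in_cos j i); rewrite leq_addr.
apply: cos_poly_in_leq (cos_poly_inM (cos_poly_in_cst i (-1)) (cos_poly_in_cos k i)).
by rewrite add0n leq_addl.
Qed.

Lemma sum_cons_tuple (T : finType) n (F : n.+1.-tuple T -> C) :
  \sum_(k : n.+1.-tuple T) F k =
  \sum_(l : T) \sum_(k : n.-tuple T) F (cons_tuple l k).
Proof.
rewrite pair_big /= (reindex (fun u : T * n.-tuple T => cons_tuple u.1 u.2)) //=.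
exists (fun k : n.+1.-tuple T => (thead k, behead_tuple k)) => [[l k] _|k _] /=.
  by rewrite theadE; congr (_, _); apply: val_inj.
by rewrite [RHS]tuple_eta; apply: val_inj.
Qed.

Variables (N : nat) (W h : R -> C) (xi : nat -> R).
Hypothesis hN : (0 < N)%N.
Hypothesis gauss : forall g : {poly C}, (size g <= 2 * N)%N ->
  cintegral (fun t : R => g.[(cos t)%:C] * W t) =
  (2 * pi)%:C * \sum_(l < N) g.[(cos (xi l))%:C] * W (xi l) / h (xi l).

Definition grid n (k : n.-tuple 'I_N) : n.-tuple R := map_tuple (fun l : 'I_N => xi l) k.

(** Induction on n: for a fixed first coordinate x the inner integral is a finite sum over the grid,
    and this sum is W(x) times a polynomial in cos x of degree at most 2N - 1. *)
Lemma iterated_gauss n (g : n.-tuple R -> C) :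
  (forall j, cos_poly_in (2 * N).-1 j g) ->
  iterated_cintegral (fun t : n.-tuple R => g t * \prod_(j < n) W (tnth t j)) =
  (2 * pi)%:C ^+ n * \sum_(k : n.-tuple 'I_N)
    g (grid k) * \prod_(j < n) (W (tnth (grid k) j) / h (tnth (grid k) j)).
Proof.
elim: n g => [|n IH] g hg.
  rewrite /= big_ord0 mulr1 expr0 mul1r (big_pred1 [tuple]) => [|k]; last first.
    by apply/esym/eqP; exact: tuple0.
  by rewrite big_ord0 mulr1; congr g; apply: val_inj.
pose wt (k : n.-tuple 'I_N) :=
  \prod_(j < n) (W (tnth (grid k) j) / h (tnth (grid k) j)).
have [q hq] : exists q : n.-tuple 'I_N -> {poly C}, forall k, (size (q k) <= 2 * N)%N /\
    forall x, g (cons_tuple x (grid k)) = (q k).[(cos x)%:C].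
  suff /choice[q hq] : forall k : n.-tuple 'I_N, exists q : {poly C},
    (size q <= 2 * N)%N /\ forall x, g (cons_tuple x (grid k)) = q.[(cos x)%:C].
    by exists q.
  move=> k; have [q sq hq] := hg ord0 (cons_tuple 0 (grid k)).
  exists q; split=> [|x]; first by rewrite (leq_trans sq) // prednK // muln_gt0.
  by rewrite -hq upd_cons0.
pose G := \sum_(k : n.-tuple 'I_N) ((2 * pi)%:C ^+ n * wt k) *: q k.
transitivity (cintegral (fun x => G.[(cos x)%:C] * W x)).
  rewrite /=; congr cintegral; apply: funext => x.
  (* For the inner integral [W x] is a constant; it joins g. *)
  have -> : (fun t : n.-tuple R => g (cons_tuple x t) *
      \prod_(j < n.+1) W (tnth (cons_tuple x t) j)) =
    (fun t => (W x * g (cons_tuple x t)) * \prod_(j < n) W (tnth t j)).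
    apply: funext => t; rewrite big_ord_recl tnth0 mulrA [W x * _]mulrC; congr (_ * _).
    by apply: eq_bigr => j _; rewrite tnthS.
  rewrite IH; last first.
    move=> j t; have [p sp hp] := hg (lift ord0 j) (cons_tuple x t).
    exists (W x *: p) => [|y]; first by rewrite (leq_trans (size_scale_leq _ _)).
    by rewrite hornerZ -hp upd_consS.
  rewrite horner_sum mulr_suml mulr_sumr; apply: eq_bigr => k _.
  by have [_ e] := hq k; rewrite hornerZ -e /wt; ring.
rewrite gauss; last first.
  apply: leq_trans (size_sum _ _ _) _; apply/bigmax_leqP => k _.
  by rewrite (leq_trans (size_scale_leq _ _)) //; case: (hq k).
rewrite exprS -mulrA; congr (_ * _); rewrite sum_cons_tuple mulr_sumr.
apply: eq_bigr => l _; rewrite horner_sum !mulr_suml mulr_sumr.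
apply: eq_bigr => k _; have [_ e] := hq k; rewrite hornerZ -e.
have -> : grid (cons_tuple l k) = cons_tuple (xi l) (grid k) by apply: val_inj.
rewrite big_ord_recl tnth0.
have -> : \prod_(j < n) (W (tnth (cons_tuple (xi l) (grid k)) (lift ord0 j)) /
    h (tnth (cons_tuple (xi l) (grid k)) (lift ord0 j))) = wt k.
  by apply: eq_bigr => j _; rewrite tnthS.
by ring.
Qed.

End IteratedGauss.

(** * Symmetrization *)

Section MevalSymmetric.
(* mpoly is only partially imported: its notations clash with those of
   mathcomp-analysis *)
Import (canonicals) mpoly.

Lemma meval_msym (R : comNzRingType) n (f : mpoly.mpoly n R) (s : 'S_n) (v : 'I_n -> R) :
  mpoly.meval v (mpoly.msym s f) = mpoly.meval (fun i => v (s i)) f.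
Proof.
rewrite [RHS]mpoly.mevalE /mpoly.msym /mpoly.mmap raddf_sum /=.
apply: eq_bigr => mon _; rewrite mpoly.mevalM mpoly.mevalC; congr (_ * _).
rewrite /mpoly.mmap1 rmorph_prod; apply: eq_bigr => i _.
by rewrite rmorphXn /= mpoly.mevalXU.
Qed.

Lemma meval_symmetric (R : comNzRingType) n (f : mpoly.mpoly n R) (s : 'S_n)
    (v : 'I_n -> R) : f \is @mpoly.symmetric n R ->
  mpoly.meval (fun i => v (s i)) f = mpoly.meval v f.
Proof. by move=> /mpoly.issymP fs; rewrite -meval_msym fs. Qed.

End MevalSymmetric.

(** Both products are squares of Vandermonde determinants, and permuting the columns changes a
    determinant only by a sign. *)
Lemma vandermonde_sqr_perm (R : comNzRingType) n (s : 'S_n) (v : 'I_n -> R) :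
  \prod_(j < n) \prod_(k < n | (j < k)%N) (v (s j) - v (s k)) ^+ 2 =
  \prod_(j < n) \prod_(k < n | (j < k)%N) (v j - v k) ^+ 2.
Proof.
have detE (u : 'I_n -> R) : \prod_(j < n) \prod_(k < n | (j < k)%N) (u j - u k) ^+ 2 =
    (\det (Vandermonde n (\row_i u i))) ^+ 2.
  rewrite det_Vandermonde -prodrXl; apply: eq_bigr => j _.
  rewrite -prodrXl; apply: eq_bigr => k _.
  by rewrite !mxE -sqrrN opprB.
rewrite !detE; have -> : Vandermonde n (\row_i v (s i)) =
    col_perm s (Vandermonde n (\row_i v i)).
  by apply/matrixP => i j; rewrite !mxE.
by rewrite col_permE det_mulmx det_perm exprMn sqrr_sign mulr1.
Qed.

(** Tuples with distinct entries are grouped by their decreasing rearrangement; each group consists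
    of n! permutations with the same value of F. *)
Lemma sum_symmetric_tuples (V : nmodType) N n (F : n.-tuple 'I_N -> V) :
  (forall k : n.-tuple 'I_N, ~~ uniq k -> F k = 0) ->
  (forall k k' : n.-tuple 'I_N, perm_eq k k' -> F k = F k') ->
  \sum_k F k =
  (\sum_(k : n.-tuple 'I_N | sorted gtn (map val k)) F k) *+ n`!.
Proof.
move=> F0 Fsym; pose r : rel 'I_N := relpre val geq.
have r_total : total r by move=> x y; exact: leq_total.
have r_trans : transitive r by move=> y x z /= xy yz; exact: leq_trans yz xy.
have r_anti : antisymmetric r.
  by move=> x y /= xy; apply/val_inj/eqP; rewrite eqn_leq andbC.
have sortedE (k : n.-tuple 'I_N) : sorted gtn (map val k) = uniq k && sorted r k.
  by rewrite gtn_sorted_uniq_geq (map_inj_uniq val_inj) sorted_map.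
transitivity (\sum_(k : n.-tuple 'I_N | uniq k) F k).
  rewrite [LHS](bigID (fun k : n.-tuple 'I_N => uniq k)) /= [X in _ + X]big1 ?addr0 //.
pose srt (k : n.-tuple 'I_N) : n.-tuple 'I_N := [tuple of sort r k].
rewrite (partition_big srt
  (fun k : n.-tuple 'I_N => sorted gtn (map val k))) /=; last first.
  by move=> k uk; rewrite sortedE /= sort_uniq uk sort_sorted.
rewrite -sumrMnl; apply: eq_bigr => k; rewrite sortedE => /andP[uk sk].
have sortk : sort r k = k by exact: sorted_sort.
have fiber (l : n.-tuple 'I_N) : uniq l && (srt l == k) = perm_eq l k.
  apply/andP/idP => [[_ /eqP lk]|lk].
    apply/(perm_sortP r_total r_trans r_anti); rewrite sortk.
    by rewrite -[in RHS]lk.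
  split; first by rewrite (perm_uniq lk).
  apply/eqP/val_inj => /=; rewrite -[RHS]sortk.
  exact/(perm_sortP r_total r_trans r_anti).
under eq_bigl do rewrite fiber.
under eq_bigr => l lk do rewrite (Fsym _ _ lk).
rewrite sumr_const; congr (_ *+ _).
(* The fibre over k corresponds to [permutations k], a duplicate-free list of n! sequences. *)
have := size_permutations uk; rewrite size_tuple => <-.
rewrite cardE -(size_map val); apply/perm_size/uniq_perm.
- by rewrite (map_inj_uniq val_inj) enum_uniq.
- exact: permutations_uniq.
move=> l; rewrite mem_permutations; apply/mapP/idP => [[l']|lk].
  by rewrite mem_enum => /= l'k ->.
have sl : size l == n by rewrite (perm_size lk) size_tuple.
by exists (Tuple sl) => //; rewrite mem_enum.
Qed.

Lemma nth_map_val n N (k : n.-tuple 'I_N) (j : 'I_n) :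
  nth 0%N (map val k) j = tnth k j.
Proof. by rewrite (nth_map (tnth k j)) ?size_tuple // -tnth_nth. Qed.

(** * Strictly decreasing tuples and the index set Lambda *)

Section LambdaReindex.
Variables m n : nat.
Hypothesis hn : (0 < n)%N.

Lemma shift_subproof (l : 'I_m.+1) (j : 'I_n) : (l + (n.-1 - j) < m + n)%N.
Proof. by have := ltn_ord l; lia. Qed.

(** Adding the staircase n - 1, ..., 1, 0 turns weak decrease into strict decrease. *)
Definition shift (l : n.-tuple 'I_m.+1) : n.-tuple 'I_(m + n) :=
  [tuple Ordinal (shift_subproof (tnth l j) j) | j < n].

(** [inord] and truncated subtraction give the intended values on strictly decreasing tuples, which
    lie above the staircase. *)
Definition unshift (k : n.-tuple 'I_(m + n)) : n.-tuple 'I_m.+1 :=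
  [tuple inord (tnth k j - (n.-1 - j)) | j < n].

Lemma unshiftK l : unshift (shift l) = l.
Proof.
by apply: eq_from_tnth => j; apply: val_inj; rewrite !tnth_mktuple /= addnK inordK.
Qed.

Lemma gtn_sorted_gap (s : seq nat) i j : sorted gtn s -> (i + j < size s)%N ->
  (nth 0 s (i + j) + j <= nth 0 s i)%N.
Proof.
move=> /(sortedP 0%N) hs; elim: j => [|j IH] hj; first by rewrite !addn0.
rewrite addnS in hj *; have := hs _ hj; have := IH (ltnW hj).
by rewrite /gtn /=; lia.
Qed.

Lemma shiftK (k : n.-tuple 'I_(m + n)) : sorted gtn (map val k) ->
  shift (unshift k) = k.
Proof.
move=> sk; have nthE := nth_map_val k.
have sz : size (map val k) = n by rewrite size_map size_tuple.
apply: eq_from_tnth => j; apply: val_inj; rewrite !tnth_mktuple /=.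
have j1 : (j <= n.-1)%N by have := ltn_ord j; lia.
(* The gap down to the last entry, which is at least 0. *)
have lo : (n.-1 - j <= tnth k j)%N.
  have := @gtn_sorted_gap (map val k) j (n.-1 - j) sk.
  by rewrite sz subnKC // prednK // leqnn nthE => /(_ isT); lia.
(* The gap up to the first entry, which is below m + n. *)
have hi : (tnth k j + j < m + n)%N.
  have := @gtn_sorted_gap (map val k) 0 j sk; rewrite sz add0n nthE => /(_ (ltn_ord j)).
  have -> : nth 0%N (map val k) 0 = tnth k (Ordinal hn) := nthE (Ordinal hn).
  by move=> h; exact: leq_ltn_trans h (ltn_ord _).
by rewrite inordK ?subnK //; lia.
Qed.

Lemma sorted_shift (l : n.-tuple 'I_m.+1) :
  sorted gtn (map val (shift l)) = (l \in Lambda m n).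
Proof.
rewrite inE; have nthS i (hi : (i < n)%N) :
    nth 0%N (map val (shift l)) i = (nth 0%N (map val l) i + (n.-1 - i))%N.
  rewrite (nth_map_val (shift l) (Ordinal hi)) (nth_map_val l (Ordinal hi)).
  by rewrite tnth_mktuple.
have sz1 : size (map val (shift l)) = n by rewrite size_map size_tuple.
have sz2 : size (map val l) = n by rewrite size_map size_tuple.
apply/(sortedP 0%N)/(sortedP 0%N) => h i; rewrite ?sz1 ?sz2 => hi; have := h i.
  by rewrite sz1 => /(_ hi); rewrite /geq /gtn /= !nthS ?(ltnW hi) //;
    move: (nth _ _ i) (nth _ _ i.+1) => u v; lia.
by rewrite sz2 => /(_ hi); rewrite /geq /gtn /= !nthS ?(ltnW hi) //;
    move: (nth _ _ i) (nth _ _ i.+1) => u v; lia.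
Qed.

Lemma sum_Lambda (V : nmodType) (F : n.-tuple 'I_(m + n) -> V) :
  \sum_(k : n.-tuple 'I_(m + n) | sorted gtn (map val k)) F k =
  \sum_(l in Lambda m n) F (shift l).
Proof.
rewrite (reindex_onto shift unshift shiftK); apply: eq_bigl => l.
by rewrite unshiftK eqxx andbT sorted_shift.
Qed.

Lemma node_shift (R : realType) (xi : nat -> R) (l : n.-tuple 'I_m.+1) :
  node xi l = grid xi (shift l).
Proof.
by apply: eq_from_tnth => j; rewrite [LHS]tnth_mktuple [RHS]tnth_map tnth_mktuple.
Qed.

End LambdaReindex.

(** * Behaviour of the summands under repetition and permutation of coordinates *)

Section Permutation.
Variables (R : realType) (n d : nat) (ep em : bool) (a : 'I_d -> R[i]).
Implicit Types x : n.-tuple R.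

(** Equal coordinates annihilate a factor of the squared Vandermonde product. *)
Lemma rho_not_injective x i j : i != j -> tnth x i = tnth x j -> rho ep em x = 0.
Proof.
wlog ij : i j / (i < j)%N => [hw|] ne e.
  by case: (ltngtP i j) => [/hw|/hw|/val_inj ij]; [exact | rewrite eq_sym; exact |
    rewrite ij eqxx in ne].
rewrite /rho [X in _ * X](bigD1 i) //= [X in _ * (X * _)](bigD1 j) //=.
by rewrite e subrr expr0n /= !mul0r mulr0.
Qed.

Variables (s : 'S_n) (x : n.-tuple R).
Let xs : n.-tuple R := [tuple tnth x (s i) | i < n].

Lemma prod_tuple_perm (V : comPzSemiRingType) (F : R -> V) :
  \prod_(j < n) F (tnth xs j) = \prod_(j < n) F (tnth x j).
Proof.
rewrite [RHS](reindex_inj (@perm_inj _ s)).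
by apply: eq_bigr => j _; rewrite tnth_mktuple.
Qed.

Lemma Rfun_perm (f : mpoly.mpoly n R[i]) : f \is @mpoly.symmetric n R[i] ->
  Rfun a f xs = Rfun a f x.
Proof.
move=> fsym; rewrite /Rfun; congr (_ / _).
  rewrite -[RHS](meval_symmetric s _ fsym); apply: mpoly.meval_eq => j.
  by rewrite tnth_mktuple.
by apply: eq_bigr => r _; exact: (prod_tuple_perm (bs_factor a r)).
Qed.

Lemma rho_perm : rho ep em xs = rho ep em x.
Proof.
rewrite /rho (prod_tuple_perm (bs_numerator ep em)); congr (_ * _).
rewrite -[RHS](vandermonde_sqr_perm s).
by apply: eq_bigr => j _; apply: eq_bigr => k _; rewrite !tnth_mktuple.
Qed.

Lemma Hfun_perm m : Hfun ep em a m xs = Hfun ep em a m x.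
Proof. exact: (prod_tuple_perm (hfun ep em a (m + n))). Qed.

End Permutation.

(** * The quadrature in n variables *)

Theorem theorem9p1 (R : realType) (n m d : nat) (ep em : bool)
    (a : 'I_d -> R[i]) (p : nat -> {poly R}) (xi : nat -> R)
    (f : mpoly.mpoly n R[i])
    (hn : (1 <= n)%N)
    (ha : forall r, `|a r| < 1)
    (hconj : conjugate_pairs a)
    (hd : (d <= 2 * (m + n) + ep + em)%N)
    (hp : is_bs_polys ep em a p)
    (hxi : is_bs_angles p (m + n) xi)
    (fsym : f \is @mpoly.symmetric n R[i])
    (fdeg : mpoly_partial_degree_le f (2 * m + 1)) :
  ((2 * pi) ^+ n * n`!%:R)^-1%:C *
    iterated_cintegral (fun x : n.-tuple R => Rfun a f x * (rho ep em x)%:C)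
  = \sum_(l in Lambda m n)
      Rfun a f (node xi l) * (rho ep em (node xi l))%:C
      * (Hfun ep em a m (node xi l))^-1.
Proof.
set N := (m + n)%N; have hN : (0 < N)%N by rewrite addn_gt0 hn orbT.
(* The integrand splits into one-variable weights W and a factor g polynomial in the cosines. *)
pose W (t : R) : R[i] := (bs_numerator ep em t)%:C / \prod_(r < d) bs_factor a r t.
pose g (t : n.-tuple R) : R[i] := mpoly.meval (fun j => (cos (tnth t j))%:C) f *
  (\prod_(j < n) \prod_(k < n | (j < k)%N) (cos (tnth t j) - cos (tnth t k)) ^+ 2)%:C.
have RfunE t : Rfun a f t * (rho ep em t)%:C = g t * \prod_(j < n) W (tnth t j).
  have -> : \prod_(j < n) W (tnth t j) = (\prod_(j < n) bs_numerator ep em (tnth t j))%:C /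
      \prod_(r < d) \prod_(j < n) bs_factor a r (tnth t j).
    by rewrite /W big_split /= prodfV rmorph_prod [in RHS]exchange_big.
  by rewrite /Rfun /rho /g rmorphM /=; ring.
have g_deg j : cos_poly_in (2 * N).-1 j g.
  apply: cos_poly_in_leq (cos_poly_inM (cos_poly_in_meval j fdeg)
    (cos_poly_in_vandermonde j)).
  (* The degree count is (2m + 1) + 2(n - 1) = 2(m + n) - 1. *)
  by rewrite /N; lia.
have hd' : (d <= 2 * N + ep + em)%N by [].
have gauss := bs_gauss_quadrature hN ha hd' hp hxi.
under [X in iterated_cintegral X]eq_fun do rewrite RfunE.
rewrite (iterated_gauss hN gauss g_deg).
pose F (k : n.-tuple 'I_N) := Rfun a f (grid xi k) * (rho ep em (grid xi k))%:C *
  (Hfun ep em a m (grid xi k))^-1.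
have FE k : g (grid xi k) * \prod_(j < n) (W (tnth (grid xi k) j) /
    hfun ep em a N (tnth (grid xi k) j)) = F k.
  by rewrite /F RfunE big_split /= prodfV mulrA.
under eq_bigr do rewrite FE.
have F0 (k : n.-tuple 'I_N) : ~~ uniq k -> F k = 0.
  move=> nu; have /injectivePn[i [j ij kij]] : ~~ injectiveb (tnth k).
    by apply: contra nu => /injectiveP /tuple_uniqP.
  by rewrite /F (rho_not_injective _ _ ij) ?mulr0 ?mul0r // !tnth_map kij.
have Fsym (k k' : n.-tuple 'I_N) : perm_eq k k' -> F k = F k'.
  move=> /tuple_permP[s /val_inj ->]; rewrite /F.
  have -> : grid xi [tuple tnth k' (s i) | i < n] = [tuple tnth (grid xi k') (s i) | i < n].
    by apply: eq_from_tnth => i; rewrite tnth_map !tnth_mktuple tnth_map.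
  by rewrite Rfun_perm // rho_perm Hfun_perm.
rewrite (sum_symmetric_tuples F0 Fsym) sum_Lambda //.
under [in RHS]eq_bigr do rewrite node_shift //.
(* The powers of 2 pi from the iteration and the n! from the orderings of the nodes cancel the
   normalisation. *)
have u0 : (2 * pi)%:C ^+ n * n`!%:R != 0 :> R[i].
  rewrite mulf_neq0 ?expf_neq0 ?fmorph_eq0 ?mulf_neq0 ?pnatr_eq0 -?lt0n ?fact_gt0 //.
  by rewrite gt_eqF // pi_gt0.
by rewrite fmorphV rmorphM rmorphXn rmorph_nat -[(\sum_(_ in _) _) *+ _]mulr_natl
  [X in _ * X]mulrA mulKf.
Qed.
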